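(* Let $n\ge2$ and let $T=(T_1,\dots,T_n)$ be a doubly commuting pure tuple on a complex Hilbert space $\mathcal{H}$. Set $$\mathcal{S}_T=\sum_{i=1}^n\Big(H^2_{\mathcal{D}_{T^*}}(\mathbb{D}^n)\cap\Theta_{T_i}H^2_{\mathcal{D}_{T_i}}(\mathbb{D}^n)\Big),\qquad \mathcal{Q}_T=\mathcal{S}_T^\perp\cong H^2_{\mathcal{D}_{T^*}}(\mathbb{D}^n)/\mathcal{S}_T,$$ where the orthogonal complement is taken in $H^2_{\mathcal{D}_{T^*}}(\mathbb{D}^n)$. Then $\mathcal{S}_T$ is a joint $(M_{z_1},\dots,M_{z_n})$-invariant subspace of $H^2_{\mathcal{D}_{T^*}}(\mathbb{D}^n)$, $\mathcal{Q}_T$ is a joint $(M_{z_1}^*,\dots,M_{z_n}^* )$-invariant subspace of $H^2_{\mathcal{D}_{T^*}}(\mathbb{D}^n)$, and $$T_i\cong P_{\mathcal{Q}_T}M_{z_i}|_{\mathcal{Q}_T}\qquad\text{for all } i=1,\dots,n,$$ i.e. there is a unitary $U:\mathcal{H}\to\mathcal{Q}_T$ with $UT_iU^*=P_{\mathcal{Q}_T}M_{z_i}|_{\mathcal{Q}_T}$ for all $i=1,\dots,n$.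
   Context: An $n$-tuple $T=(T_1,\dots,T_n)$ of contractions on $\mathcal{H}$ is doubly commuting if $T_iT_j=T_jT_i$ for all $i,j$ and $T_iT_j^*=T_j^*T_i$ for all $i\neq j$. It is a doubly commuting pure tuple if, in addition, every $T_i$ is of class $C_{\cdot 0}$, i.e. $T_i^{*m}\to 0$ strongly as $m\to\infty$. Put $D_{T_i}=(I-T_i^*T_i)^{1/2}$, $D_{T_i^*}=(I-T_iT_i^* )^{1/2}$, $\mathcal{D}_{T_i}=\overline{\mathrm{ran}}\,D_{T_i}$, $\mathcal{D}_{T_i^*}=\overline{\mathrm{ran}}\,D_{T_i^*}$. For a doubly commuting tuple the operators $D_{T_i^*}$ commute with each other, and one sets $D_{T^*}=\prod_{i=1}^n D_{T_i^*}$ and $\mathcal{D}_{T^*}=\overline{\mathrm{ran}}\,D_{T^*}\subseteq\mathcal{D}_{T_i^*}$. For a Hilbert space $\mathcal{E}$, $H^2_{\mathcal{E}}(\mathbb{D}^n)\cong H^2(\mathbb{D}^n)\otimes\mathcal{E}$ is the $\mathcal{E}$-valued Hardy space over the polydisc, and $M_{z_i}$ is multiplication by the coordinate function $z_i$ (here on $H^2_{\mathcal{D}_{T^*}}(\mathbb{D}^n)$). $P_{\mathcal{Q}}$ denotes the orthogonal projection onto $\mathcal{Q}$. Since $\mathcal{D}_{T^*}\subseteq\mathcal{D}_{T_i^*}$, $H^2_{\mathcal{D}_{T^*}}(\mathbb{D}^n)$ is a closed subspace of $H^2_{\mathcal{D}_{T_i^*}}(\mathbb{D}^n)$. The characteristic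 function of $T_i$ is $\theta_{T_i}(z)=\big(-T_i+D_{T_i^*}(I-zT_i^* )^{-1}zD_{T_i}\big)|_{\mathcal{D}_{T_i}}:\mathcal{D}_{T_i}\to\mathcal{D}_{T_i^*}$, $z\in\mathbb{D}$. Define $\Theta_{T_i}(\boldsymbol{z})=\theta_{T_i}(z_i)$ for $\boldsymbol{z}\in\mathbb{D}^n$; this is a bounded holomorphic $\mathcal{B}(\mathcal{D}_{T_i},\mathcal{D}_{T_i^*})$-valued function, and $\Theta_{T_i}H^2_{\mathcal{D}_{T_i}}(\mathbb{D}^n)=\{\Theta_{T_i}f: f\in H^2_{\mathcal{D}_{T_i}}(\mathbb{D}^n)\}\subseteq H^2_{\mathcal{D}_{T_i^*}}(\mathbb{D}^n)$, where $(\Theta_{T_i}f)(\boldsymbol{z})=\theta_{T_i}(z_i)f(\boldsymbol{z})$. *)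

(* Defs.v *)
From HB Require Import structures.
From mathcomp Require Import all_boot all_order all_algebra sesquilinear finmap.
From mathcomp Require Import all_classical all_reals all_analysis.
From mathcomp Require Import complex summability.

Set Implicit Arguments.
Unset Strict Implicit.
Unset Printing Implicit Defensive.

Import Order.TTheory GRing.Theory Num.Theory numFieldNormedType.Exports.

Local Open Scope classical_set_scope.
Local Open Scope ring_scope.
Local Open Scope complex_scope.

(* The following notions take an inner product [d], linear in its first
   argument, together with the carrier [V] on which it is considered. They thus
   apply both to an abstract Hilbert space ([V = setT]) and to a Hilbert space
   that is realised as a set of functions, such as the Hardy spaces below.
   Operators are total functions, of which only the values on [V] matter. *)

(* For [A] bounded from [V] to [W], [V] complete and [y] in [W], the vector [x]
   exists and is unique by the Riesz theorem; 0 is only a dummy value. *)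
Definition adjoint (C : numClosedFieldType) (X Y : lmodType C)
    (dX : X -> X -> C) (V : set X) (dY : Y -> Y -> C)
    (A : X -> Y) (y : Y) : X :=
  xget 0 [set x | V x /\ forall u, V u -> dY (A u) y = dX u x].

Definition orthocomplement (C : numClosedFieldType) (X : lmodType C)
    (d : X -> X -> C) (V S : set X) : set X :=
  [set f | V f /\ forall g, S g -> d g f = 0].

Definition orthoproj (C : numClosedFieldType) (X : lmodType C)
    (d : X -> X -> C) (Q : set X) (x : X) : X :=
  xget 0 [set q | Q q /\ forall y, Q y -> d (x - q) y = 0].

(* Closedness is with respect to the norm of [d]. An inequality [0 < e] in [C]
   forces [e] to be real. *)
Definition closed_subspace (C : numClosedFieldType) (X : lmodType C)
    (d : X -> X -> C) (V S : set X) : Prop :=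
  [/\ S `<=` V,
      S 0,
      (forall (a : C) f g, S f -> S g -> S (a *: f + g)) &
      forall f, V f ->
        (forall e : C, 0 < e -> exists2 g, S g & d (f - g) (f - g) < e) ->
        S f].

Definition invariant_under (X : Type) (A : X -> X) (S : set X) : Prop :=
  forall f, S f -> S (A f).

Definition unitary_onto (C : numClosedFieldType) (X Y : lmodType C)
    (dX : X -> X -> C) (V : set X) (dY : Y -> Y -> C) (W : set Y)
    (U : X -> Y) : Prop :=
  (forall x y, V x -> V y -> dY (U x) (U y) = dX x y) /\ U @` V = W.

Definition hadjoint (R : realType) (H : completeNormedModType R[i])
    (dot : H -> H -> R[i]) (T : H -> H) : H -> H :=
  adjoint dot setT dot T.

(* The positive square root of a positive bounded operator. *)
Definition op_sqrt (R : realType) (H : completeNormedModType R[i])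
    (dot : H -> H -> R[i]) (A : H -> H) : H -> H :=
  xget (fun=> 0) [set B | [/\ linear B, continuous B,
                              forall x, 0 <= dot (B x) x & B \o B = A]].

Definition defect (R : realType) (H : completeNormedModType R[i])
    (dot : H -> H -> R[i]) (T : H -> H) : H -> H :=
  op_sqrt dot (fun x => x - hadjoint dot T (T x)).

Definition defect_adj (R : realType) (H : completeNormedModType R[i])
    (dot : H -> H -> R[i]) (T : H -> H) : H -> H :=
  op_sqrt dot (fun x => x - T (hadjoint dot T x)).

Definition defect_space (R : realType) (H : completeNormedModType R[i])
    (dot : H -> H -> R[i]) (T : H -> H) : set H :=
  closure (range (defect dot T)).

Definition joint_defect_adj (R : realType) (H : completeNormedModType R[i])
    (dot : H -> H -> R[i]) (n : nat) (T : 'I_n -> H -> H) : H -> H :=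
  \big[(fun f g => f \o g)/idfun]_(i < n) defect_adj dot (T i).

Definition joint_defect_adj_space (R : realType)
    (H : completeNormedModType R[i]) (dot : H -> H -> R[i]) (n : nat)
    (T : 'I_n -> H -> H) : set H :=
  closure (range (joint_defect_adj dot T)).

Definition doubly_commuting (R : realType) (H : completeNormedModType R[i])
    (dot : H -> H -> R[i]) (n : nat) (T : 'I_n -> H -> H) : Prop :=
  (forall i j, T i \o T j = T j \o T i) /\
  (forall i j, i != j ->
     T i \o hadjoint dot (T j) = hadjoint dot (T j) \o T i).

Definition contraction_op (R : realType) (H : completeNormedModType R[i])
    (T : H -> H) : Prop :=
  forall x, `|T x| <= `|x|.

Definition class_C_dot_0 (R : realType) (H : completeNormedModType R[i])
    (dot : H -> H -> R[i]) (T : H -> H) : Prop :=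
  forall x, (fun m => iter m (hadjoint dot T) x) @ \oo --> (0 : H).

Definition doubly_commuting_pure (R : realType)
    (H : completeNormedModType R[i]) (dot : H -> H -> R[i]) (n : nat)
    (T : 'I_n -> {linear H -> H}) : Prop :=
  [/\ forall i, contraction_op (T i),
      doubly_commuting dot (fun i => T i : H -> H) &
      forall i, class_C_dot_0 dot (T i)].

Definition polydisc (R : realType) (n : nat) : set ('I_n -> R[i]) :=
  [set z | forall i, `|z i| < 1].
Arguments polydisc : clear implicits.

Definition monomial (R : realType) (n : nat) (k : {ffun 'I_n -> nat})
    (z : polydisc R n) : R[i] :=
  \prod_(i < n) (\val z i) ^+ k i.

(* [f] is the sum of the power series with square summable coefficients [a]. *)
Definition hardy_series (R : realType) (H : completeNormedModType R[i])
    (n : nat) (f : polydisc R n -> H) (a : {ffun 'I_n -> nat} -> H) : Prop :=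
  (exists M : R[i], forall J : {fset {ffun 'I_n -> nat}},
     partial_sum (fun k => `|a k| ^+ 2) J <= M) /\
  (forall z, partial_sum (fun k => monomial k z *: a k) @ totally --> f z).

(* The Hardy space with values in a closed subspace [E] of [H]; all of these are
   subspaces of one space of [H]-valued functions, so that for [E `<=` F] the
   space [hardy E] is contained in [hardy F]. *)
Definition hardy (R : realType) (H : completeNormedModType R[i]) (n : nat)
    (E : set H) : set (polydisc R n -> H) :=
  [set f | exists2 a, (forall k, E (a k)) & hardy_series f a].

(* The coefficients of an element of the Hardy space are unique. *)
Definition hardy_coef (R : realType) (H : completeNormedModType R[i])
    (n : nat) (f : polydisc R n -> H) : {ffun 'I_n -> nat} -> H :=
  xget (fun=> 0) [set a | hardy_series f a].

Definition hardy_dot (R : realType) (H : completeNormedModType R[i])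
    (n : nat) (dot : H -> H -> R[i]) (f g : polydisc R n -> H) : R[i] :=
  sum (fun k => dot (hardy_coef f k) (hardy_coef g k) : R[i]^o).

Definition mult_coord (R : realType) (H : completeNormedModType R[i])
    (n : nat) (i : 'I_n) (f : polydisc R n -> H) : polydisc R n -> H :=
  fun z => \val z i *: f z.

(* The characteristic function, as a function on all of [H]; it is to be
   restricted to the defect space of [T]. The operator I - z T^* is bijective
   when T is a contraction and |z| < 1, so that [pinv_] is its inverse. *)
Definition char_fun (R : realType) (H : completeNormedModType R[i])
    (dot : H -> H -> R[i]) (T : H -> H) (z : R[i]) (x : H) : H :=
  - T x + defect_adj dot T
            ('pinv_(fun=> 0) setT (fun y => y - z *: hadjoint dot T y)
               (z *: defect dot T x)).

Definition char_mult (R : realType) (H : completeNormedModType R[i])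
    (dot : H -> H -> R[i]) (n : nat) (T : 'I_n -> H -> H) (i : 'I_n)
    (f : polydisc R n -> H) : polydisc R n -> H :=
  fun z => char_fun dot (T i) (\val z i) (f z).

Definition model_hardy (R : realType) (H : completeNormedModType R[i])
    (dot : H -> H -> R[i]) (n : nat) (T : 'I_n -> H -> H) :
    set (polydisc R n -> H) :=
  hardy (joint_defect_adj_space dot T).

Definition S_T (R : realType) (H : completeNormedModType R[i])
    (dot : H -> H -> R[i]) (n : nat) (T : 'I_n -> H -> H) :
    set (polydisc R n -> H) :=
  [set f | exists2 g : 'I_n -> (polydisc R n -> H),
     (forall i, (model_hardy dot T `&`
        char_mult dot T i @` hardy (defect_space dot (T i))) (g i)) &
     f = \sum_(i < n) g i].

Definition Q_T (R : realType) (H : completeNormedModType R[i])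
    (dot : H -> H -> R[i]) (n : nat) (T : 'I_n -> H -> H) :
    set (polydisc R n -> H) :=
  orthocomplement (hardy_dot dot) (model_hardy dot T) (S_T dot T).

(* Main.v *)
Require Import Defs.
From HB Require Import structures.
From mathcomp Require Import all_boot all_order all_algebra sesquilinear finmap.
From mathcomp Require Import all_classical all_reals all_analysis.
From mathcomp Require Import complex summability.
From mathcomp Require Import ring lra.

Set Implicit Arguments.
Unset Strict Implicit.
Unset Printing Implicit Defensive.

Import Order.TTheory GRing.Theory Num.Theory numFieldNormedType.Exports.

Local Open Scope classical_set_scope.
Local Open Scope ring_scope.
Local Open Scope complex_scope.

(** Write T' for the adjoint of a contraction T, D for the square root of
    I - T'T and Ds for the square root of I - TT'.

    One operator. The matrix with rows (T', D) and (Ds, -T) is unitary, and the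
    characteristic function theta of T is its transfer function: an input
    sequence u drives the states x(0) = 0, x(m+1) = T' x(m) + D u(m), and
    multiplication by theta sends u to the output y(m) = Ds x(m) - T u(m).
    Because the matrix is unitary the recursion can also be run backwards. From
    a square summable y one gets the states x(m) as the sums of T^j Ds y(m+j)
    over j, and inputs u(m) = D x(m+1) - T' y(m), such that y is the output of u
    with initial state x(0). Splitting off the free response Ds T'^m x(0), what
    is left of y is theta times u. So y is a multiple of theta plus a sequence
    (Ds T'^m x)_m, and these two kinds of sequences are orthogonal when the
    powers of T' tend strongly to 0. Conservation of energy controls all norms.

    Several operators. Functions in the Hardy space of the polydisc are families
    of coefficients indexed by multi-indices, and Theta_i acts on them along the
    slices in the i-th direction. The dilation sends x to the function U x whose
    coefficients are the products over i of Ds_i T_i'^(k_i) applied to x. It is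
    isometric, one variable at a time (mcoef_isometry), and it intertwines T_i'
    with the backward shift (model_coef_succ, mult_coord_dilation). Removing the
    part of a coefficient family that lies in the range of Theta_i, successively
    for all i, leaves products of the Ds_i T_i'^(k_i) applied to one vector
    (char_range_decomposition): double commutativity lets the operators of
    different indices pass each other. Hence every element of the model space is
    g + U x with g in S_T, and g is orthogonal to the range of U
    (char_range_orthogonal).

    From this decomposition everything follows formally: S_T is the orthogonal
    complement of the range of U, so it is closed, Q_T is the range of U, and
    the compression of M_i to Q_T corresponds to T_i because the adjoint of M_i
    maps U x to U T_i' x.

    The analytic ingredients are the Riesz theorem (riesz), the existence and
    uniqueness of positive square roots (op_sqrtE), summation over multi-indices
    slice by slice (has_sum_slices) and the uniqueness of power series
    coefficients (hsum_inj). *)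

(** * Inner products and contractions *)

Section InnerProduct.
Context (R : realType) (H : completeNormedModType R[i]) (dot : {dot H for Num.conj}).
Hypothesis hdot : forall x, dot x x = `|x| ^+ 2.
Local Notation C := (R[i]).

Lemma dotDl x y z : dot (x + y) z = dot x z + dot y z.
Proof. exact: linearDl. Qed.
Lemma dotBl x y z : dot (x - y) z = dot x z - dot y z.
Proof. exact: linearBl. Qed.
Lemma dotZl a x z : dot (a *: x) z = a * dot x z.
Proof. exact: linearZl_LR. Qed.
Lemma dotDr x y z : dot x (y + z) = dot x y + dot x z.
Proof. exact: linearDr. Qed.
Lemma dotBr x y z : dot x (y - z) = dot x y - dot x z.
Proof. exact: linearBr. Qed.
Lemma dotZr a x z : dot x (a *: z) = Num.conj a * dot x z.
Proof. by rewrite linearZr_LR. Qed.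
Lemma dot0l x : dot 0 x = 0.
Proof. exact: linear0l. Qed.
Lemma dot0r x : dot x 0 = 0.
Proof. exact: linear0r. Qed.
Lemma dotC x y : dot x y = Num.conj (dot y x).
Proof. by rewrite hermC /= expr0 mul1r. Qed.

Lemma dot_eq0 x : dot x x = 0 -> x = 0.
Proof. by rewrite hdot => /eqP; rewrite sqrf_eq0 normr_eq0 => /eqP. Qed.

Lemma dot_injr x y : (forall z, dot z x = dot z y) -> x = y.
Proof. by move=> e; apply/subr0_eq/dot_eq0; rewrite dotBr e subrr. Qed.

Lemma cauchy_schwarz x y : `|dot x y| <= `|x| * `|y|.
Proof.
have [->|y0] := eqVneq y 0; first by rewrite dot0r !normr0 mulr0.
pose v := `|y| ^+ 2 *: x - dot x y *: y.
have ny : 0 < `|y| ^+ 2 by rewrite exprn_gt0 // normr_gt0.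
have nc : Num.conj (`|y| ^+ 2) = `|y| ^+ 2.
  by rewrite conj_Creal // ger0_real // ltW.
have e : dot v v = `|y| ^+ 2 * (`|y| ^+ 2 * `|x| ^+ 2 - `|dot x y| ^+ 2).
  rewrite /v !(dotBl, dotBr, dotZl, dotZr) nc !hdot normCK (dotC y x).
  by ring.
have : 0 <= dot v v by rewrite hdot exprn_ge0.
rewrite e pmulr_rge0 // subr_ge0 -exprMn => le.
by rewrite -(@ler_pXn2r _ 2) ?nnegrE // ?mulr_ge0 // mulrC.
Qed.

Lemma norm_sqr_le (x y : H) : `|x| ^+ 2 <= `|y| ^+ 2 -> `|x| <= `|y|.
Proof. by rewrite ler_pXn2r // nnegrE. Qed.

Definition adjoint_pair (A B : H -> H) := forall x y, dot (A x) y = dot x (B y).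

Lemma adjoint_pairC A B : adjoint_pair A B -> adjoint_pair B A.
Proof. by move=> h x y; rewrite dotC -h -dotC. Qed.

(** All operators of the proof are linear contractions; the predicate is on bare
    functions because adjoints and square roots are obtained as such. *)
Definition lcontr (A : H -> H) := linear A /\ forall x, `|A x| <= `|x|.

Section LinearContraction.
Variable A : H -> H.
Hypothesis hA : lcontr A.

Lemma lcZD a x y : A (a *: x + y) = a *: A x + A y.
Proof. by case: hA => h h2; rewrite ?h ?h2. Qed.
Lemma lcD x y : A (x + y) = A x + A y.
Proof. by have := lcZD 1 x y; rewrite !scale1r. Qed.
Lemma lc0 : A 0 = 0.
Proof. by apply: (addrI (A 0)); rewrite -lcD !addr0. Qed.
Lemma lcZ a x : A (a *: x) = a *: A x.
Proof. by have := lcZD a x 0; rewrite lc0 !addr0. Qed.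
Lemma lcN x : A (- x) = - A x.
Proof. by rewrite -scaleN1r lcZ scaleN1r. Qed.
Lemma lcB x y : A (x - y) = A x - A y.
Proof. by rewrite lcD lcN. Qed.
Lemma lc_sum (I : Type) (r : seq I) (P : pred I) (f : I -> H) :
  A (\sum_(i <- r | P i) f i) = \sum_(i <- r | P i) A (f i).
Proof. by apply: (big_morph A lcD lc0). Qed.
Lemma lc_norm x : `|A x| <= `|x|.
Proof. by case: hA => h h2; rewrite ?h ?h2. Qed.
Lemma lc_norm2 x : `|A x| ^+ 2 <= `|x| ^+ 2.
Proof. by rewrite ler_pXn2r ?nnegrE // lc_norm. Qed.

Lemma lc_cvg {I : Type} {F : set_system I} {FF : Filter F} (u : I -> H) l :
  u @ F --> l -> (A \o u) @ F --> A l.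
Proof.
move=> /cvgrPdist_lt h; apply/cvgrPdist_lt => e e0; move: (h e e0).
by apply: filterS => t /=; rewrite -lcB; apply: le_lt_trans; apply: lc_norm.
Qed.

Lemma lc_continuous : continuous A.
Proof. by move=> x; apply: lc_cvg. Qed.
End LinearContraction.

Lemma dot_cvg {I : Type} {F : set_system I} {FF : Filter F} (u : I -> H) l y :
  u @ F --> l -> (fun t => dot (u t) y : C^o) @ F --> (dot l y : C^o).
Proof.
move=> /cvgrPdist_lt h; apply/cvgrPdist_lt => e e0.
have p : 0 < `|y| + 1 by rewrite ltr_wpDl.
have := h (e / (`|y| + 1)); rewrite divr_gt0 // => /(_ isT).
apply: filterS => t; rewrite ltr_pdivlMr // -dotBl; apply: le_lt_trans.
by apply: le_trans (cauchy_schwarz _ _) _; rewrite ler_wpM2l // lerDl.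
Qed.

Lemma dot_cvgr {I : Type} {F : set_system I} {FF : Filter F} (u : I -> H) l y :
  u @ F --> l -> (fun t => dot y (u t) : C^o) @ F --> (dot y l : C^o).
Proof.
move=> /cvgrPdist_lt h; apply/cvgrPdist_lt => e e0.
have p : 0 < `|y| + 1 by rewrite ltr_wpDl.
have := h (e / (`|y| + 1)); rewrite divr_gt0 // => /(_ isT).
apply: filterS => t; rewrite ltr_pdivlMr // -dotBr; apply: le_lt_trans.
by apply: le_trans (cauchy_schwarz _ _) _; rewrite mulrC ler_wpM2l // lerDl.
Qed.

End InnerProduct.

Lemma cvgn_of_cauchy (K : numFieldType) (V : completeNormedModType K) (u : nat -> V) :
  (forall e : K, 0 < e -> exists N, forall m, (N <= m)%N -> `|u N - u m| < e) ->
  cvgn u.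
Proof.
move=> h; apply/cauchy_cvgP/cauchy_exP => e e0.
have [N hN] := h e e0; exists (u N); exists N => // m /= Nm.
by rewrite -ball_normE /=; apply: hN.
Qed.

Lemma cvg_uniq (K : numFieldType) (V : normedModType K) (I : Type)
    (F : set_system I) (FF : ProperFilter F) (u : I -> V) (l l' : V) :
  u @ F --> l -> u @ F --> l' -> l = l'.
Proof. by move=> h h'; apply: norm_cvg_unique h h'. Qed.

(** * The Riesz theorem and adjoints *)

Section Riesz.
Context (R : realType) (H : completeNormedModType R[i]) (dot : {dot H for Num.conj}).
Hypothesis hdot : forall x, dot x x = `|x| ^+ 2.
Local Notation C := (R[i]).

Section Functional.
Variables (phi : H -> C) (c : C).
Hypothesis c_ge0 : 0 <= c.
Hypothesis phi_lin : forall a x y, phi (a *: x + y) = a * phi x + phi y.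
Hypothesis phi_bnd : forall x, `|phi x| <= c * `|x|.

(** The vector representing [phi] is the minimiser of this functional. *)
Let energy u : C := `|u| ^+ 2 - (phi u + Num.conj (phi u)).

Let energy_real u : energy u = (complex.Re (energy u))%:C.
Proof.
rewrite RRe_real // /energy rpredB ?rpredX ?normr_real //.
by apply/CrealP; rewrite rmorphD /= conjCK addrC.
Qed.

Let energy_ge u : - c ^+ 2 <= energy u.
Proof.
rewrite /energy lerBrDr.
have h : phi u + Num.conj (phi u) <= c * `|u| *+ 2.
  have r : phi u + Num.conj (phi u) \is Num.real.
    by apply/CrealP; rewrite rmorphD /= conjCK addrC.
  apply: le_trans (real_ler_norm r) _; apply: le_trans (ler_normD _ _) _.
  by rewrite norm_conjC -mulr2n lerMn2r phi_bnd orbT.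
apply: le_trans (lerD (lexx _) h) _; rewrite -subr_ge0.
have -> : `|u| ^+ 2 - (- c ^+ 2 + c * `|u| *+ 2) = (`|u| - c) ^+ 2 by ring.
by apply: real_exprn_even_ge0 => //; rewrite rpredB ?normr_real ?ger0_real.
Qed.

Let energy_step u w (t : C) : Num.conj t = t -> let s := phi w - dot w u in
  energy (u + (t * Num.conj s) *: w) =
  energy u + t ^+ 2 * `|s| ^+ 2 * `|w| ^+ 2 - t * `|s| ^+ 2 *+ 2.
Proof.
move=> tr s; have phiE : phi (u + (t * Num.conj s) *: w) = t * Num.conj s * phi w + phi u.
  by rewrite addrC phi_lin.
rewrite /energy phiE -!hdot !(dotDl, dotDr, dotZl, dotZr) !(rmorphM, rmorphD) /=.
rewrite !conjCK tr !normCK (dotC dot u w).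
have -> : phi w = s + dot w u by rewrite /s subrK.
rewrite rmorphD /=; ring.
Qed.

(** At an almost minimiser [u], moving in the direction of [w] by the optimal
    step, which is [phi w - dot w u] divided by the square of the norm of [w],
    cannot lower the energy by more than the remaining gap. So [u] represents
    [phi] up to an error that is small relative to [w]. *)
Let almost_minimizer d e u : (forall v, d <= energy v) -> 0 <= e ->
  energy u <= d + e ^+ 2 -> forall w, `|phi w - dot w u| <= e * `|w|.
Proof.
move=> dmin e0 ue w; set s := phi w - dot w u.
have [->|w0] := eqVneq s 0; first by rewrite normr0 mulr_ge0.
have ww : 0 < `|w| ^+ 2.
  rewrite exprn_gt0 // normr_gt0; apply: contra_neq w0 => w0.
  have := phi_bnd w; rewrite /s w0 dot0l subr0 normr0 mulr0 normr_le0 => /eqP->//.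
have tr : Num.conj (`|w| ^+ 2)^-1 = (`|w| ^+ 2)^-1.
  by rewrite conj_Creal // ger0_real // invr_ge0 ltW.
have := energy_step u w tr; rewrite -/s /= => E.
have := dmin (u + ((`|w| ^+ 2)^-1 * Num.conj s) *: w); rewrite E => le.
have {}le : (`|w| ^+ 2)^-1 * `|s| ^+ 2 <= e ^+ 2.
  rewrite -(lerD2l d); apply: le_trans ue; rewrite -lerBrDr.
  apply: le_trans le _; rewrite le_eqVlt; apply/orP; left; apply/eqP.
  by field; move: (lt0r_neq0 ww); rewrite sqrf_eq0.
have {}le : `|s| ^+ 2 <= (e * `|w|) ^+ 2 by rewrite exprMn -ler_pdivrMr // mulrC.
by rewrite ler_pXn2r ?nnegrE ?mulr_ge0 // in le.
Qed.

(** A minimising sequence is Cauchy: two almost minimisers [u] and [v] both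
    represent [phi] approximately, and testing this against [u - v] bounds the
    norm of [u - v]. The limit represents [phi] exactly. *)
Lemma riesz : exists x, forall u, phi u = dot u x.
Proof.
pose E := range (fun u => complex.Re (energy u)).
have Einf : has_inf E.
  split; first by exists (complex.Re (energy 0)); exists 0.
  exists (complex.Re (- c ^+ 2)) => _ [u _ <-].
  by have := energy_ge u; rewrite lecE => /andP[].
pose d := inf E.
have dmin v : d%:C <= energy v.
  by rewrite energy_real lecR; apply: (ge_inf Einf.2); exists v.
have ex n : exists u, energy u <= d%:C + (n.+1%:R^-1) ^+ 2.
  have [|r [u _ <-] ru] := @inf_adherent _ E (n.+1%:R^-1 ^+ 2) _ Einf.
    by rewrite exprn_gt0 // invr_gt0.
  exists u; rewrite energy_real.
  have -> : (n.+1%:R^-1 ^+ 2 : C) = ((n.+1%:R^-1) ^+ 2)%:C.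
    by rewrite rmorphXn /= fmorphV /= rmorph_nat.
  by rewrite -rmorphD lecR ltW.
have [u hu] := choice ex.
have hs n w : `|phi w - dot w (u n)| <= n.+1%:R^-1 * `|w|.
  by apply: almost_minimizer (hu n) _.
have u_cauchy n m : `|u n - u m| <= n.+1%:R^-1 + m.+1%:R^-1.
  have [->|nm] := eqVneq (u n - u m) 0; first by rewrite normr0 addr_ge0 ?invr_ge0.
  rewrite -(@ler_pM2r _ `|u n - u m|) ?normr_gt0 // -expr2 -hdot dotBr.
  set w := u n - u m.
  have -> : dot w (u n) - dot w (u m) = (phi w - dot w (u m)) - (phi w - dot w (u n)).
    by ring.
  have := lerD (hs m w) (hs n w); rewrite -mulrDl (addrC m.+1%:R^-1).
  apply: le_trans; apply: le_trans (real_ler_norm _) (ler_normB _ _).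
  have -> : phi w - dot w (u m) - (phi w - dot w (u n)) = `|w| ^+ 2.
    by rewrite -hdot [in RHS]/w dotBr; ring.
  by rewrite rpredX ?normr_real.
have inv_small (e : C) : 0 < e -> exists N, forall n, (N <= n)%N -> n.+1%:R^-1 < e.
  move=> e0; have er : e = (complex.Re e)%:C by rewrite RRe_real ?gtr0_real.
  have e0' : 0 < complex.Re e by rewrite er ltcR in e0.
  exists (Num.truncn (complex.Re e)^-1) => n Nn.
  have -> : (n.+1%:R^-1 : C) = (n.+1%:R^-1)%:C by rewrite fmorphV /= rmorph_nat.
  rewrite er ltcR invf_plt ?posrE //.
  apply: lt_le_trans (truncnS_gt _) _; by rewrite ler_nat ltnS.
have /cvg_ex[x ux] : cvgn u.
  apply: cvgn_of_cauchy => e e0; have [N hN] := inv_small (e / 2) (divr_gt0 e0 (ltr0Sn _ 1)).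
  exists N => m Nm; apply: le_lt_trans (u_cauchy _ _) _.
  by rewrite [e]splitr ltrD ?hN.
exists x => w; apply/eqP; rewrite -subr_eq0 -normr_le0.
apply/ler_addgt0Pl => e e0; rewrite addr0.
have p : 0 < `|w| + 1 by rewrite ltr_wpDl.
have e2 : 0 < e / 2 by rewrite divr_gt0.
have [N hN] := inv_small (e / 2 / (`|w| + 1)) (divr_gt0 e2 p).
have hc : (fun n => dot w (u n) : C^o) @ \oo --> (dot w x : C^o) by exact: dot_cvgr.
move/cvgrPdist_lt in hc.
have [M _ hM] := hc _ e2.
pose n := maxn N M; have := hM n (leq_maxr _ _); rewrite distrC => hn.
rewrite -(subrK (dot w (u n)) (phi w)) -addrA [e]splitr.
apply: le_trans (ler_normD _ _) (lerD _ (ltW hn)).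
apply: le_trans (hs n w) _; have := hN n (leq_maxl _ _); rewrite ltr_pdivlMr // => /ltW.
by apply: le_trans; rewrite ler_wpM2l ?invr_ge0 // lerDl.
Qed.

End Functional.

Lemma hadjointP T : lcontr T -> adjoint_pair dot T (hadjoint dot T).
Proof.
move=> hT x y; have [z hz] : exists z, forall u, dot (T u) y = dot u z.
  apply: (@riesz _ `|y|) => [|a u v|u]; first exact: normr_ge0.
    by rewrite (lcZD hT) dotDl dotZl.
  apply: le_trans (cauchy_schwarz hdot _ _) _.
  by rewrite mulrC ler_wpM2l // (lc_norm hT).
rewrite /hadjoint /adjoint; set X := [set _ | _].
by have [_ ->] : X (xget 0 X) by apply: (@xgetPex _ 0 X); exists z; split.
Qed.

Lemma adjoint_pair_lcontr A B : lcontr A -> adjoint_pair dot A B -> lcontr B.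
Proof.
move=> hA hAB; split.
  by move=> a x y; apply: (dot_injr hdot) => z; rewrite dotDr dotZr -!hAB dotDr dotZr.
move=> x; have [->|x0] := eqVneq (B x) 0; first by rewrite normr0.
rewrite -(@ler_pM2r _ `|B x|) ?normr_gt0 // -expr2 -hdot -hAB.
have := cauchy_schwarz hdot (A (B x)) x.
have -> : `|dot (A (B x)) x| = dot (A (B x)) x.
  by rewrite ger0_norm // hAB hdot exprn_ge0.
by move/le_trans; apply; rewrite mulrC ler_wpM2l // (lc_norm hA).
Qed.

Lemma hadjoint_lcontr T : lcontr T -> lcontr (hadjoint dot T).
Proof. by move=> hT; apply: adjoint_pair_lcontr (hadjointP hT). Qed.

End Riesz.

(** * Positive square roots *)

Section ScalarIteration.
Variable R : realType.

(** The iteration for [1 - sqrt (1 - t)] at [t = 1]; its increments dominate those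
    of the same iteration carried out with a contraction in place of [t]. *)
Fixpoint sqrt_scalar (m : nat) : R :=
  if m is k.+1 then (1 + sqrt_scalar k ^+ 2) / 2 else 0.

Lemma sqrt_scalar_bounds m : 0 <= sqrt_scalar m <= 1.
Proof. elim: m => [|m /andP[h0 h1]] /=; nra. Qed.

Lemma sqrt_scalar_incr m : sqrt_scalar m <= sqrt_scalar m.+1.
Proof. rewrite /= -subr_ge0; have := sqr_ge0 (sqrt_scalar m - 1); nra. Qed.

Lemma sqrt_scalar_homo : {homo sqrt_scalar : n m / (n <= m)%N >-> n <= m}.
Proof. by apply: homo_leq; [exact: lexx|exact: le_trans|exact: sqrt_scalar_incr]. Qed.

Lemma sqrt_scalar_cauchy (e : R) : 0 < e ->
  exists N, forall m, (N <= m)%N -> sqrt_scalar m - sqrt_scalar N < e.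
Proof.
move=> e0; have /cvg_ex[l hl] : cvgn sqrt_scalar.
  apply: nondecreasing_is_cvgn; first exact: sqrt_scalar_homo.
  by exists 1 => _ [m _ <-]; case/andP: (sqrt_scalar_bounds m).
have e2 : 0 < e / 2 by rewrite divr_gt0.
move/cvgrPdist_lt/(_ _ e2): hl => [N _ hN]; exists N => m Nm.
have := hN N (leqnn N); have := hN m Nm; rewrite !ltr_norml /=; lra.
Qed.
End ScalarIteration.

Section SquareRoot.
Context (R : realType) (H : completeNormedModType R[i]) (dot : {dot H for Num.conj}).
Hypothesis hdot : forall x, dot x x = `|x| ^+ 2.
Local Notation C := (R[i]).

Fixpoint sqrt_iter (K : H -> H) (m : nat) (x : H) : H :=
  if m is k.+1 then 2^-1 *: (K x + sqrt_iter K k (sqrt_iter K k x)) else 0.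

(** The square root of [I - K]. *)
Definition sqrt_id_sub (K : H -> H) (x : H) : H := x - limn (fun m => sqrt_iter K m x).

Section Iterates.
Variable K : H -> H.
Hypothesis hK : lcontr K.
Let a m : C := (sqrt_scalar R m)%:C.

Let aS m : a m.+1 = (1 + a m ^+ 2) / 2.
Proof. by rewrite /a /= rmorphM rmorphD rmorphXn fmorphV rmorph_nat rmorph1. Qed.
Let a_ge0 m : 0 <= a m.
Proof. by rewrite ler0c; case/andP: (sqrt_scalar_bounds R m). Qed.
Let a_le1 m : a m <= 1.
Proof. by rewrite (_ : 1 = 1%:C) // lecR; case/andP: (sqrt_scalar_bounds R m). Qed.
Let a_incr m : a m <= a m.+1.
Proof. by rewrite lecR sqrt_scalar_incr. Qed.

Let iter_lin m : linear (sqrt_iter K m).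
Proof.
elim: m => [|m IH] c x y /=; first by rewrite scaler0 addr0.
rewrite !IH (lcZD hK) !scalerDr !scalerA (mulrC 2^-1) -!addrA; congr (_ + _).
by rewrite addrCA.
Qed.

Let iter_bound m x : `|sqrt_iter K m x| <= a m * `|x|.
Proof.
elim: m x => [|m IH] x /=; first by rewrite normr0 mulr_ge0.
rewrite normrZ aS ger0_norm ?invr_ge0 // (mulrC (1 + _)) -mulrA.
rewrite ler_wpM2l ?invr_ge0 //; apply: le_trans (ler_normD _ _) _.
rewrite mulrDl mul1r lerD ?(lc_norm hK) //; apply: le_trans (IH _) _.
by rewrite expr2 -mulrA ler_wpM2l.
Qed.

Let iter_sub m x y : sqrt_iter K m (x - y) = sqrt_iter K m x - sqrt_iter K m y.
Proof. by rewrite -scaleN1r addrC iter_lin scaleN1r addrC. Qed.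

(** The difference of the squares of two consecutive iterates [Y'] and [Y] is
    [Y' (Y' - Y) + (Y' - Y) Y], and half of it is the next increment, so the
    increments are bounded by the scalar ones by induction. *)
Let iter_step m x :
  `|sqrt_iter K m.+1 x - sqrt_iter K m x| <= (a m.+1 - a m) * `|x|.
Proof.
elim: m x => [|m IH] x.
  rewrite subr0 /=; apply: le_trans (iter_bound 1 x) _.
  by rewrite (_ : a 0 = 0) // subr0.
set Y := sqrt_iter K m in IH *; set Y' := sqrt_iter K m.+1 in IH *.
have -> : sqrt_iter K m.+2 x - Y' x = 2^-1 *: (Y' (Y' x - Y x) + (Y' (Y x) - Y (Y x))).
  rewrite /Y' iter_sub -/Y' [X in X - _]/= -/Y' [X in _ - X]/= -/Y.
  rewrite -scalerBr opprD addrACA subrr add0r; congr (_ *: _).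
  by rewrite addrA subrK.
rewrite normrZ ger0_norm ?invr_ge0 //.
have -> : (a m.+2 - a m.+1) * `|x| =
    2^-1 * (a m.+1 * ((a m.+1 - a m) * `|x|) + (a m.+1 - a m) * (a m * `|x|)).
  have hp : 1 = a m.+1 * 2 - a m ^+ 2 by rewrite aS; field.
  by rewrite (aS m.+1) {1}hp; field.
rewrite ler_wpM2l ?invr_ge0 //; apply: le_trans (ler_normD _ _) (lerD _ _).
  by apply: le_trans (iter_bound _ _) _; rewrite ler_wpM2l.
apply: le_trans (IH _) _; rewrite ler_wpM2l ?subr_ge0 //; exact: iter_bound.
Qed.

Let iter_dist N m x : (N <= m)%N ->
  `|sqrt_iter K N x - sqrt_iter K m x| <= (a m - a N) * `|x|.
Proof.
move=> /subnK <-; elim: (m - N)%N => [|k IH]; first by rewrite !subrr normr0 mul0r.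
rewrite addSn distrC -(subrK (sqrt_iter K (k + N) x) (sqrt_iter K _.+1 x)) -addrA.
apply: le_trans (ler_normD _ _) _; rewrite (distrC _ (sqrt_iter K N x)).
by apply: le_trans (lerD (iter_step _ _) IH) _; rewrite -mulrDl subrKA.
Qed.

Let Y x := limn (fun m => sqrt_iter K m x).

Lemma sqrt_iter_cvg x : (fun m => sqrt_iter K m x) @ \oo --> Y x.
Proof.
apply: cvgn_of_cauchy => e e0; have er : e = (complex.Re e)%:C by rewrite RRe_real ?gtr0_real.
have p : 0 < `|x| + 1 by rewrite ltr_wpDl.
have q : 0 < e / (`|x| + 1) by rewrite divr_gt0.
have qr : e / (`|x| + 1) = (complex.Re (e / (`|x| + 1)))%:C by rewrite RRe_real ?gtr0_real.
have q' : 0 < complex.Re (e / (`|x| + 1)) by rewrite qr ltcR in q.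
have [N hN] := sqrt_scalar_cauchy q'; exists N => m Nm.
apply: le_lt_trans (iter_dist _ Nm) _.
have : a m - a N < e / (`|x| + 1) by rewrite qr -rmorphB ltcR hN.
rewrite ltr_pdivlMr //; apply: le_lt_trans.
rewrite ler_wpM2l ?lerDl // subr_ge0 lecR; exact: sqrt_scalar_homo.
Qed.

Let Y_lcontr : lcontr Y.
Proof.
split=> [c x y|x].
  apply: (@cvg_uniq _ H nat \oo _ (fun m => sqrt_iter K m (c *: x + y))); first exact: sqrt_iter_cvg.
  under eq_fun do rewrite iter_lin.
  apply: cvgD; last exact: sqrt_iter_cvg.
  by apply: cvgZl_tmp; exact: sqrt_iter_cvg.
apply/ler_addgt0Pl => e e0.
have := @sqrt_iter_cvg x; move/cvgrPdist_lt/(_ _ e0) => [N _ /(_ N (leqnn N))] /= h.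
rewrite -(subrK (sqrt_iter K N x) (Y x)); apply: le_trans (ler_normD _ _) (lerD (ltW h) _).
by apply: le_trans (iter_bound _ _) _; rewrite ler_piMl.
Qed.

(** The iteration converges to a solution of [2 Y = K + Y ^ 2], that is of
    [(I - Y) ^ 2 = I - K]. *)
Let Y_fix x : Y x = 2^-1 *: (K x + Y (Y x)).
Proof.
have h : (fun m => sqrt_iter K m (sqrt_iter K m x)) @ \oo --> Y (Y x).
  apply/cvgrPdist_lt => e e0; have e2 : 0 < e / 2 by rewrite divr_gt0.
  move: (@sqrt_iter_cvg x) (@sqrt_iter_cvg (Y x)) => /cvgrPdist_lt/(_ _ e2) h1 /cvgrPdist_lt/(_ _ e2) h2.
  near=> m.
  rewrite -(subrK (sqrt_iter K m (Y x)) (Y (Y x))) -addrA [e]splitr -iter_sub.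
  apply: le_lt_trans (ler_normD _ _) (ltrD _ _); first by near: m.
  apply: le_lt_trans (iter_bound _ _) _; apply: le_lt_trans (_ : `|Y x - sqrt_iter K m x| < _).
    by rewrite ler_piMl.
  by near: m.
apply: (@cvg_uniq _ H nat \oo _ (fun m => sqrt_iter K m.+1 x)).
  by have := @sqrt_iter_cvg x; rewrite -(cvg_shiftS (fun m => sqrt_iter K m x)).
by apply: cvgZl_tmp; apply: cvgD h; exact: cvg_cst.
Unshelve. all: by end_near. Qed.

Lemma sqrt_id_sub_linear : linear (sqrt_id_sub K).
Proof.
move=> c x y; rewrite -[LHS]/(c *: x + y - Y (c *: x + y)) (lcZD Y_lcontr).
by rewrite scalerBr opprD addrACA.
Qed.

Lemma sqrt_id_subK x : sqrt_id_sub K (sqrt_id_sub K x) = x - K x.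
Proof.
rewrite -[LHS]/(x - Y x - Y (x - Y x)) (lcB Y_lcontr).
have -> : K x = 2 *: Y x - Y (Y x).
  by rewrite [Y x]Y_fix scalerA divff ?pnatr_eq0 // scale1r -Y_fix addrK.
rewrite scaler_nat mulr2n; rewrite !opprB !opprD !addrA; congr (_ + _).
by rewrite addrAC.
Qed.

Hypothesis Ksym : adjoint_pair dot K K.

Let iter_sym m : adjoint_pair dot (sqrt_iter K m) (sqrt_iter K m).
Proof.
elim: m => [|m IH] x y /=; first by rewrite dot0l dot0r.
rewrite dotZl dotZr dotDl dotDr Ksym !IH.
by rewrite (_ : Num.conj (2^-1) = 2^-1) // fmorphV rmorph_nat.
Qed.

Lemma sqrt_id_sub_sym : adjoint_pair dot (sqrt_id_sub K) (sqrt_id_sub K).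
Proof.
move=> x y; rewrite /sqrt_id_sub dotBl dotBr; congr (_ - _).
apply: (@cvg_uniq _ C^o nat \oo _ (fun m => dot (sqrt_iter K m x) y : C^o)).
  by apply: dot_cvg => //; exact: sqrt_iter_cvg.
under eq_fun do rewrite iter_sym.
by apply: dot_cvgr => //; exact: sqrt_iter_cvg.
Qed.

Lemma sqrt_id_sub_ge0 x : 0 <= dot (sqrt_id_sub K x) x.
Proof.
rewrite /sqrt_id_sub -/(Y x) dotBl subr_ge0 hdot.
have r : dot (Y x) x \is Num.real.
  apply/CrealP; rewrite -dotC; have := sqrt_id_sub_sym x x.
  by rewrite /sqrt_id_sub -/(Y x) dotBl dotBr => /addrI/oppr_inj.
apply: le_trans (real_ler_norm r) _; apply: le_trans (cauchy_schwarz hdot _ _) _.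
by rewrite expr2 ler_wpM2r // (lc_norm Y_lcontr).
Qed.

Hypothesis Kpos : forall x, 0 <= dot (K x) x.

Lemma sqrt_id_sub_lcontr : lcontr (sqrt_id_sub K).
Proof.
split; first exact: sqrt_id_sub_linear.
move=> x; apply: norm_sqr_le; rewrite -!hdot sqrt_id_sub_sym sqrt_id_subK dotBr.
by rewrite -Ksym gerBl.
Qed.
End Iterates.

(** An intertwining relation passes to all iterates and hence to the limits. It
    yields both the commutation of defect operators and the relations between
    the two defect operators of one contraction. *)
Lemma sqrt_id_sub_intertwine X K1 K2 : lcontr X -> lcontr K1 -> lcontr K2 ->
  (forall x, X (K1 x) = K2 (X x)) ->
  forall x, X (sqrt_id_sub K1 x) = sqrt_id_sub K2 (X x).
Proof.
move=> hX h1 h2 XK x; rewrite /sqrt_id_sub (lcB hX); congr (_ - _).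
apply: (@cvg_uniq _ H nat \oo _ (fun m => X (sqrt_iter K1 m x))).
  by apply: (lc_cvg hX); exact: sqrt_iter_cvg.
have -> : (fun m => X (sqrt_iter K1 m x)) = (fun m => sqrt_iter K2 m (X x)).
  apply/funext => m; elim: m x => [|m IH] x /=; first by rewrite (lc0 hX).
  by rewrite (lcZ hX) (lcD hX) XK !IH.
exact: sqrt_iter_cvg.
Qed.

End SquareRoot.

Section PositiveSquareRoot.
Context (R : realType) (H : completeNormedModType R[i]) (dot : {dot H for Num.conj}).
Hypothesis hdot : forall x, dot x x = `|x| ^+ 2.
Local Notation C := (R[i]).

(** Polarization: the values at [x + y] and at ['i x + y] show that [f x y] equals
    both [- f y x] and [f y x]. *)
Lemma sesquilinear_diag0 (f : H -> H -> C) :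
  (forall a x y z, f (a *: x + y) z = a * f x z + f y z) ->
  (forall a x y z, f z (a *: x + y) = Num.conj a * f z x + f z y) ->
  (forall x, f x x = 0) -> forall x y, f x y = 0.
Proof.
move=> fl fr f0.
have fD x y : f x y + f y x = 0.
  have := f0 (1 *: x + y); rewrite fl !fr rmorph1 !mul1r !f0 addr0 add0r.
  by rewrite addrC.
move=> x y.
have e : f x y - f y x = 0.
  have i0 : ('i%R : C) != 0 by exact: neq0Ci.
  have := f0 ('i%R *: x + y); rewrite fl !fr conjCi !f0 mulr0 addr0 add0r => e.
  by apply: (mulfI i0); rewrite mulr0 -[RHS]e; ring.
have := fD x y; have -> : f y x = f x y by rewrite -[LHS]add0r -e subrK.
by move/eqP; rewrite -mulr2n mulrn_eq0 => /eqP.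
Qed.

Lemma positive_sym (B : H -> H) : linear B -> (forall x, 0 <= dot (B x) x) ->
  adjoint_pair dot B B.
Proof.
move=> Blin Bpos x y; apply: subr0_eq.
apply: (sesquilinear_diag0 (f := fun x y => dot (B x) y - dot x (B y))).
- by move=> a u v w; rewrite Blin !(dotDl, dotZl); ring.
- by move=> a u v w; rewrite Blin !(dotDr, dotZr); ring.
- by move=> u; rewrite [dot u _]dotC (CrealP _) ?subrr // ger0_real.
Qed.

(** The Cauchy-Schwarz argument for the semi-definite form of [B]: its values at
    [B y - t y] are affine in [t] with slope a negative multiple of the square
    of the norm of [B y], and remain nonnegative. *)
Lemma positive_null (B : H -> H) y : linear B -> (forall x, 0 <= dot (B x) x) ->
  dot (B y) y = 0 -> B y = 0.
Proof.
move=> Blin Bpos y0; have Bsym := positive_sym Blin Bpos.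
have BD x z : B (x + z) = B x + B z by have := Blin 1 x z; rewrite !scale1r.
have B0 : B 0 = 0 by apply: (addrI (B 0)); rewrite -BD !addr0.
have BZ a x : B (a *: x) = a *: B x by have := Blin a x 0; rewrite B0 !addr0.
pose w := B y; pose p := dot (B w) w.
have p0 : 0 <= p by exact: Bpos.
(* the value of the form at w - t y, for t real *)
have key (t : C) : 0 <= t -> 0 <= p - 2 * t * `|w| ^+ 2.
  move=> t0; have := Bpos (w + (- t) *: y).
  rewrite BD BZ !(dotDl, dotDr, dotZl, dotZr) -/p y0 -/w hdot (Bsym w y) -/w hdot.
  rewrite (_ : Num.conj (- t) = - t); first by congr (0 <= _); ring.
  by rewrite conj_Creal // rpredN ger0_real.
apply/eqP; rewrite -normr_eq0 -sqrf_eq0 -/w; apply/negPn/negP => w0.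
have w1 : 0 < `|w| ^+ 2 by rewrite lt_neqAle eq_sym w0 exprn_ge0.
have := key _ (divr_ge0 (addr_ge0 p0 ler01) (ltW w1)).
have -> : p - 2 * ((p + 1) / `|w| ^+ 2) * `|w| ^+ 2 = - (p + 2).
  by field; move: (lt0r_neq0 w1); rewrite sqrf_eq0.
rewrite oppr_ge0 => h; have := lt_le_trans (ltr_wpDl p0 (ltr0Sn _ 1)) h.
by rewrite ltxx.
Qed.

(** Uniqueness: any positive square root [B] of [I - K] commutes with [K], hence
    with the constructed root [S]. For [y = (S - B) x] the relation
    [(S + B) (S - B) = 0] makes both forms vanish at [y], so [S y = B y = 0] and
    the norm of [y] is 0. *)
Lemma op_sqrtE K : lcontr K -> adjoint_pair dot K K -> (forall x, 0 <= dot (K x) x) ->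
  op_sqrt dot (fun x => x - K x) = sqrt_id_sub K.
Proof.
move=> hK Ksym Kpos; rewrite /op_sqrt; set P := [set _ | _].
pose S := sqrt_id_sub K.
have hS : lcontr S by exact: sqrt_id_sub_lcontr Ksym Kpos.
have Spos : forall x, 0 <= dot (S x) x by exact: sqrt_id_sub_ge0.
have PS : P S.
  split=> //; first by case: hS.
    exact: lc_continuous.
  by apply/funext => x; exact: sqrt_id_subK.
have [Blin _ Bpos B2] : P (xget (fun=> 0) P) by apply: xgetPex; exists S.
set B := xget _ _ in Blin Bpos B2 *.
have B2E x : B (B x) = x - K x by have := congr1 (@^~ x) B2.
have Bsym := positive_sym Blin Bpos.
have hB : lcontr B.
  split=> // x; apply: norm_sqr_le; rewrite -!hdot Bsym B2E dotBr -Ksym.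
  by rewrite gerBl.
have BK x : B (K x) = K (B x).
  by rewrite -[K x](subKr x) -B2E (lcB hB) (B2E (B x)) subKr.
have BS x : B (S x) = S (B x) by exact: sqrt_id_sub_intertwine.
have S2 x : S (S x) = x - K x by exact: sqrt_id_subK.
apply/funext => x; pose y := S x - B x.
have e : S y + B y = 0 by rewrite /y (lcB hS) (lcB hB) S2 B2E BS addrA subrK subrr.
have : dot (S y) y + dot (B y) y = 0 by rewrite -dotDl e dot0l.
move/eqP; rewrite paddr_eq0 // => /andP[/eqP sy /eqP bY].
have {}sy := positive_null hS.1 Spos sy; have {}bY := positive_null hB.1 Bpos bY.
apply/esym/subr0_eq; rewrite -/y; apply: (dot_eq0 hdot).
rewrite {1}/y dotBl /S (sqrt_id_sub_sym hdot hK Ksym) -/S sy.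
by rewrite Bsym bY !dot0r subrr.
Qed.

(** * Defect operators *)

Section Defects.
Variable T : H -> H.
Hypothesis hT : lcontr T.
Local Notation Ts := (hadjoint dot T).
Local Notation D := (defect dot T).
Local Notation Ds := (defect_adj dot T).

Let hTs : lcontr Ts := hadjoint_lcontr hdot hT.
Let TTs : adjoint_pair dot T Ts := hadjointP hdot hT.
Let TsT : adjoint_pair dot Ts T := adjoint_pairC TTs.

Lemma lcontr_comp A B : lcontr A -> lcontr B -> lcontr (fun x : H => A (B x)).
Proof.
move=> hA hB; split=> [a x y|x]; first by rewrite (lcZD hB) (lcZD hA).
by apply: le_trans (lc_norm hA _) (lc_norm hB _).
Qed.

Let hK1 := lcontr_comp hTs hT.
Let hK2 := lcontr_comp hT hTs.

Let K1sym : adjoint_pair dot (fun x => Ts (T x)) (fun x => Ts (T x)).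
Proof. by move=> x y; rewrite TsT TTs. Qed.
Let K2sym : adjoint_pair dot (fun x => T (Ts x)) (fun x => T (Ts x)).
Proof. by move=> x y; rewrite TTs TsT. Qed.
Let K1pos x : 0 <= dot (Ts (T x)) x.
Proof. by rewrite TsT hdot exprn_ge0. Qed.
Let K2pos x : 0 <= dot (T (Ts x)) x.
Proof. by rewrite TTs hdot exprn_ge0. Qed.

Let DE : D = sqrt_id_sub (fun x => Ts (T x)).
Proof. exact: op_sqrtE. Qed.
Let DsE : Ds = sqrt_id_sub (fun x => T (Ts x)).
Proof. exact: op_sqrtE. Qed.

Lemma defect_lcontr : lcontr D.
Proof. by rewrite DE; apply: sqrt_id_sub_lcontr K1sym K1pos. Qed.
Lemma defect_adj_lcontr : lcontr Ds.
Proof. by rewrite DsE; apply: sqrt_id_sub_lcontr K2sym K2pos. Qed.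
Lemma defect_sym : adjoint_pair dot D D.
Proof. by rewrite DE; apply: sqrt_id_sub_sym. Qed.
Lemma defect_adj_sym : adjoint_pair dot Ds Ds.
Proof. by rewrite DsE; apply: sqrt_id_sub_sym. Qed.
Lemma defectK x : D (D x) = x - Ts (T x).
Proof. by rewrite DE; apply: sqrt_id_subK. Qed.
Lemma defect_adjK x : Ds (Ds x) = x - T (Ts x).
Proof. by rewrite DsE; apply: sqrt_id_subK. Qed.
Lemma defect_intertwine x : T (D x) = Ds (T x).
Proof. by rewrite DE DsE; apply: sqrt_id_sub_intertwine. Qed.
Lemma defect_adj_intertwine x : Ts (Ds x) = D (Ts x).
Proof. by rewrite DE DsE; apply: sqrt_id_sub_intertwine. Qed.
Lemma defect_adj_comm X : lcontr X -> (forall x, X (T x) = T (X x)) ->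
  (forall x, X (Ts x) = Ts (X x)) -> forall x, X (Ds x) = Ds (X x).
Proof.
move=> hX XT XTs x; rewrite DsE; apply: sqrt_id_sub_intertwine => // y.
by rewrite XT XTs.
Qed.
End Defects.
End PositiveSquareRoot.

(** * Unconditional sums *)

Local Existing Instance totally_filter.

Section FiniteSums.
Variables (I : choiceType).

Lemma partial_sumE (V : zmodType) (c : I -> V) J : partial_sum c J = \sum_(i <- J) c i.
Proof. by rewrite /partial_sum big_seq_fsetE. Qed.

Lemma fset_of_uniq (s : seq I) : uniq s -> exists2 A : {fset I}, A =i s &
  forall (V : zmodType) (c : I -> V), \sum_(i <- A) c i = \sum_(i <- s) c i.
Proof.
move=> us; exists [fset x in s]%fset; first by move=> x; rewrite !inE.
move=> V c; apply: perm_big; apply: uniq_perm => //.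
by move=> x; rewrite !inE.
Qed.

Lemma ler_sum_fset (K : numDomainType) (b : I -> K) (A B : {fset I}) :
  (forall i, 0 <= b i) -> (A `<=` B)%fset -> \sum_(i <- A) b i <= \sum_(i <- B) b i.
Proof.
move=> b0 /fsubsetP AB; rewrite [leRHS](big_fsetID _ (mem A)) /=.
have -> : [fset x in B | x \in A]%fset = A.
  by apply/fsetP => x; rewrite !inE andbC; case: (boolP (x \in A)) => // /AB ->.
by rewrite lerDl sumr_ge0.
Qed.

Lemma sum_fsetD (V : zmodType) (c : I -> V) (A B : {fset I}) : (A `<=` B)%fset ->
  \sum_(i <- B) c i - \sum_(i <- A) c i = \sum_(i <- (B `\` A)%fset) c i.
Proof.
move=> /fsubsetP AB; rewrite (big_fsetID _ (mem A)) /=.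
have -> : [fset x in B | x \in A]%fset = A.
  by apply/fsetP => x; rewrite !inE andbC; case: (boolP (x \in A)) => // /AB ->.
rewrite addrAC subrr add0r; apply: (congr1 (fun Z : {fset I} => \sum_(i <- Z) c i)).
by apply/fsetP => x; rewrite !inE andbC.
Qed.
End FiniteSums.

Section HasSum.
Context (I : choiceType) (K : numFieldType) (V : normedModType K).
Implicit Types (c : I -> V).

(** A record rather than a synonym for the convergence, which unfolds to a
    quantification over neighbourhoods and would be instantiated as such. *)
Record has_sum c (s : V) : Prop := HasSum { has_sum_cvg : partial_sum c @ totally --> s }.

Lemma has_sumP c s : has_sum c s <-> forall e : K, 0 < e -> exists J0 : {fset I},
  forall J : {fset I}, (J0 `<=` J)%fset -> `|s - \sum_(i <- J) c i| < e.
Proof.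
split.
  move=> [/cvgrPdist_lt h] e /h [J0 _ hJ].
  by exists J0 => J J0J; rewrite -partial_sumE; apply: hJ.
move=> h; constructor; apply/cvgrPdist_lt => e /h[J0 hJ]; exists J0 => // J J0J.
by rewrite partial_sumE; apply: hJ.
Qed.

Lemma has_sum_uniq c s s' : has_sum c s -> has_sum c s' -> s = s'.
Proof. by move=> [h] [h']; exact: cvg_uniq h h'. Qed.

Lemma has_sum_sum c s : has_sum c s -> summability.sum c = s.
Proof. by move=> [h]; apply: norm_cvg_lim. Qed.

Lemma has_sumD c c' s s' : has_sum c s -> has_sum c' s' ->
  has_sum (fun i => c i + c' i) (s + s').
Proof.
move=> [h] [h']; constructor.
have -> : partial_sum (fun i => c i + c' i) = (fun J => partial_sum c J + partial_sum c' J).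
  by apply/funext => J; rewrite !partial_sumE big_split.
exact: cvgD.
Qed.

Lemma has_sumZ a c s : has_sum c s -> has_sum (fun i => a *: c i) (a *: s).
Proof.
move=> [h]; constructor.
have -> : partial_sum (fun i => a *: c i) = (fun J => a *: partial_sum c J).
  by apply/funext => J; rewrite !partial_sumE scaler_sumr.
exact: cvgZl_tmp.
Qed.

Lemma has_sumB c c' s s' : has_sum c s -> has_sum c' s' ->
  has_sum (fun i => c i - c' i) (s - s').
Proof.
move=> h h'; rewrite -scaleN1r; apply: has_sumD => //.
by under eq_fun do rewrite -scaleN1r; exact: has_sumZ.
Qed.

Lemma has_sum_single c k : (forall i, i != k -> c i = 0) -> has_sum c (c k).
Proof.
move=> ck; apply/has_sumP => e e0; exists [fset k]%fset => J kJ.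
rewrite -(big_fset_incl _ kJ) ?big_seq_fset1 ?subrr ?normr0 // => i _.
by rewrite inE => /ck.
Qed.

Lemma has_sum0 c : (forall i, c i = 0) -> has_sum c 0.
Proof.
move=> c0; apply/has_sumP => e e0; exists fset0 => J _.
by rewrite big1 ?subrr ?normr0.
Qed.
End HasSum.

(** Reindexing along an injection, extended by 0 outside its image; [tau] serves
    to decide membership in the image. *)
Lemma has_sum_inj (I J : choiceType) (K : numFieldType) (V : normedModType K)
    (sigma : I -> J) (tau : J -> I) (c : I -> V) s : cancel sigma tau ->
  has_sum c s ->
  has_sum (fun j => if sigma (tau j) == j then c (tau j) else 0) s.
Proof.
move=> st /has_sumP h; apply/has_sumP => e /h [J0 hJ0].
exists (sigma @` J0)%fset => B /fsubsetP J0B.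
have [|A Am hA] := @fset_of_uniq _ [seq tau j | j <- B & sigma (tau j) == j].
  rewrite map_inj_in_uniq ?filter_uniq ?fset_uniq // => x y.
  by rewrite !mem_filter => /andP[/eqP<- _] /andP[/eqP<- _]; rewrite !st => ->.
have -> : \sum_(i <- B) (if sigma (tau i) == i then c (tau i) else 0) = \sum_(i <- A) c i.
  by rewrite hA big_map big_filter [RHS]big_mkcond.
apply: hJ0; apply/fsubsetP => i iJ0; rewrite Am; apply/mapP; exists (sigma i); last by rewrite st.
by rewrite mem_filter st eqxx J0B // in_imfset.
Qed.

Section Bounded.
Context (I : choiceType) (K : numFieldType).

Definition sums_le (b : I -> K) (M : K) := forall J : {fset I}, \sum_(i <- J) b i <= M.

Lemma sums_le_ge0 b M : sums_le b M -> 0 <= M.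
Proof. by move=> /(_ fset0); rewrite big_seq_fset0. Qed.

Lemma sums_le_point b M k : sums_le b M -> b k <= M.
Proof. by move=> /(_ [fset k]%fset); rewrite big_seq_fset1. Qed.

Lemma le_sums_le b b' M : (forall i, b i <= b' i) -> sums_le b' M -> sums_le b M.
Proof. by move=> bb h J; apply: le_trans (h J); apply: ler_sum. Qed.

Lemma sums_leD b b' M M' : sums_le b M -> sums_le b' M' ->
  sums_le (fun i => b i + b' i) (M + M').
Proof. by move=> h h' J; rewrite big_split lerD. Qed.

Lemma sums_leZ a b M : 0 <= a -> sums_le b M -> sums_le (fun i => a * b i) (a * M).
Proof. by move=> a0 h J; rewrite -mulr_sumr ler_wpM2l. Qed.
End Bounded.

Lemma cvg_le_cst (K : numFieldType) (u : nat -> K) (l M : K) :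
  (u : nat -> K^o) @ \oo --> (l : K^o) -> (forall n, u n <= M) -> l <= M.
Proof.
move=> ul uM; rewrite -subr_ge0; apply/normr_idP.
apply: (@cvg_uniq _ K^o nat \oo _ (fun n => M - u n : K^o)).
  have -> : (fun n => M - u n : K^o) = (fun n => `|M - u n| : K^o).
    by apply/funext => n; rewrite ger0_norm ?subr_ge0.
  by apply: cvg_norm; apply: cvgB ul; exact: cvg_cst.
by apply: cvgB ul; exact: cvg_cst.
Qed.

Lemma cvg_subr0 (K : numFieldType) (V : normedModType K) (u : nat -> V) (l : V) :
  u @ \oo --> 0 -> (fun N => l - u N) @ \oo --> l.
Proof.
move=> u0; have : (fun N => l - u N) @ \oo --> l - 0 by apply: cvgB u0; exact: cvg_cst.
by rewrite subr0.
Qed.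

Lemma cvg_sum_seq (K : numFieldType) (V : normedModType K) (J : Type) (r : seq J)
    (P : pred J) (u : J -> nat -> V) (l : J -> V) : (forall j, P j -> u j @ \oo --> l j) ->
  (fun N => \sum_(j <- r | P j) u j N) @ \oo --> \sum_(j <- r | P j) l j.
Proof.
move=> ul; elim: r => [|j r IH].
  by rewrite big_nil; under eq_fun do rewrite big_nil; exact: cvg_cst.
rewrite big_cons; under eq_fun do rewrite big_cons.
by case: ifP => // /ul h; exact: (cvgD h IH).
Qed.

(** The order is only partial, so that the limit is first shown to be real:
    the difference of [s] and a finite sum is a limit of nonnegative numbers,
    hence equal to its norm. *)
Lemma has_sum_ub (K : numFieldType) (I : choiceType) (b : I -> K) (s : K) :
  (forall i, 0 <= b i) -> has_sum (b : I -> K^o) (s : K^o) -> sums_le b s.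
Proof.
move=> b0 /has_sumP bs J; rewrite -subr_ge0; set x := s - _.
apply/normr_idP/eqP; rewrite -subr_eq0 -normr_le0.
apply/ler_addgt0Pl => e e0; rewrite addr0.
have [J0 /(_ _ (fsubsetUl J0 J)) h] := bs _ (divr_gt0 e0 (ltr0Sn _ 1)).
pose y := \sum_(i <- (J0 `|` J)%fset) b i - \sum_(i <- J) b i.
have y0 : `|y| = y by apply/normr_idP; rewrite subr_ge0; exact: ler_sum_fset (fsubsetUr _ _).
have xy : `|x - y| <= e / 2 by rewrite /x /y opprB addrA subrK ltW.
rewrite [e]splitr -(subrK y `|x|) -addrA; apply: le_trans (ler_normD _ _) (lerD _ _).
  by rewrite -{1}y0; apply: le_trans (ler_dist_dist _ _) xy.
by rewrite distrC.
Qed.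

Section Suprema.
Context (R : realType).
Local Notation C := (R[i]).

(** Being nonnegative, the elements are real, and the supremum is taken in [R]. *)
Lemma csup (E : set C) (M : C) : E !=set0 -> (forall x, E x -> 0 <= x <= M) ->
  exists s : C, (forall x, E x -> x <= s) /\ forall e, 0 < e -> exists2 x, E x & s < x + e.
Proof.
move=> [x0 Ex0] EM; pose F := [set complex.Re x | x in E].
have rE x : E x -> x = (complex.Re x)%:C.
  by move=> /EM/andP[x_ge _]; rewrite RRe_real ?ger0_real.
have Fsup : has_sup F.
  split; first by exists (complex.Re x0), x0.
  by exists (complex.Re M) => _ [x /EM/andP[_ xM] <-]; move: xM; rewrite lecE => /andP[].
exists (sup F)%:C; split.
  by move=> x Ex; rewrite (rE x Ex) lecR; apply: (ub_le_sup Fsup.2); exists x.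
move=> e e0; have er : e = (complex.Re e)%:C by rewrite RRe_real ?gtr0_real.
have e0' : 0 < complex.Re e by rewrite er ltcR in e0.
have [_ [x Ex <-] hx] := sup_adherent e0' Fsup; exists x => //.
by rewrite (rE x Ex) er -rmorphD ltcR /= -ltrBlDr.
Qed.

Lemma has_sum_nonneg (I : choiceType) (b : I -> C) (M : C) : (forall i, 0 <= b i) ->
  sums_le b M -> exists2 s : C, has_sum (b : I -> C^o) (s : C^o) & sums_le b s.
Proof.
move=> b0 bM; pose E := [set x : C | exists J : {fset I}, x = \sum_(i <- J) b i].
have [|x [J ->]|s [sub sadh]] := @csup E M; first by exists 0, fset0; rewrite big_seq_fset0.
  by rewrite bM sumr_ge0.
exists s; last by move=> J; apply: sub; exists J.
apply/has_sumP => e e0; have [_ [J0 ->] hJ0] := sadh e e0; exists J0 => J J0J.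
rewrite ger0_norm; last by rewrite subr_ge0; apply: sub; exists J.
rewrite ltrBlDr addrC; apply: lt_le_trans hJ0 _; by rewrite lerD2r ler_sum_fset.
Qed.


(** Absolute summability: beyond a finite set that almost realises the supremum
    of the sums of norms, sums over further finite sets are small. *)
Lemma has_sum_abs (I : choiceType) (V : completeNormedModType C) (c : I -> V) (M : C) :
  sums_le (fun i => `|c i|) M -> exists s, has_sum c s.
Proof.
move=> cM; pose E := [set x : C | exists J : {fset I}, x = \sum_(i <- J) `|c i|].
have [|x [J ->]|s [sub sadh]] := @csup E M; first by exists 0, fset0; rewrite big_seq_fset0.
  by rewrite cM sumr_ge0.
suff : cvg (partial_sum c @ totally) by move=> /cvg_ex[l hl]; exists l.
apply/cauchy_cvgP/cauchy_exP => e e0; have [_ [J0 ->] hJ0] := sadh e e0.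
exists (\sum_(i <- J0) c i); exists J0 => // J /= J0J.
rewrite -ball_normE /= distrC partial_sumE sum_fsetD //; apply: le_lt_trans (ler_norm_sum _ _ _) _.
rewrite -(sum_fsetD _ J0J) ltrBlDr addrC; apply: le_lt_trans hJ0.
by apply: sub; exists J.
Qed.

Lemma series_tail (b : nat -> C) (M : C) : (forall m, 0 <= b m) ->
  (forall N, \sum_(m < N) b m <= M) -> forall e, 0 < e ->
  exists N, forall m, (N <= m)%N -> \sum_(k < m) b k - \sum_(k < N) b k < e.
Proof.
move=> b0 bM e e0; pose E := [set x : C | exists N, x = \sum_(m < N) b m].
have [|x [J ->]|s [sub sadh]] := @csup E M; first by exists 0, 0%N; rewrite big_ord0.
  by rewrite bM sumr_ge0.
have [_ [N ->] hN] := sadh e e0; exists N => m _.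
by rewrite ltrBlDr addrC; apply: le_lt_trans hN; apply: sub; exists m.
Qed.
End Suprema.

(** * Multi-indices and slices *)

Section MultiIndex.
Context (n : nat).
Local Notation I := {ffun 'I_n -> nat}.
Implicit Types (i j : 'I_n) (k : I).

(** Every [k] lies on the slice through [upd i 0 k] in direction [i], at height
    [k i]. *)
Definition upd i m k : I := [ffun j => if j == i then m else k j].
Definition midx_succ i k := upd i (k i).+1 k.
Definition midx_pred i k := upd i (k i).-1 k.

Lemma updE i m k j : upd i m k j = if j == i then m else k j.
Proof. by rewrite ffunE. Qed.
Lemma upd_same i m k : upd i m k i = m.
Proof. by rewrite updE eqxx. Qed.
Lemma upd_other i j m k : j != i -> upd i m k j = k j.
Proof. by move=> /negPf ji; rewrite updE ji. Qed.
Lemma upd_id i k : upd i (k i) k = k.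
Proof. by apply/ffunP => j; rewrite updE; case: eqP => [->|]. Qed.
Lemma upd_upd i m m' k : upd i m (upd i m' k) = upd i m k.
Proof. by apply/ffunP => j; rewrite !updE; case: eqP. Qed.
Lemma succK i : cancel (midx_succ i) (midx_pred i).
Proof. by move=> k; rewrite /midx_pred /midx_succ upd_same upd_upd /= upd_id. Qed.
Lemma succ_pred i k : (midx_succ i (midx_pred i k) == k) = (k i != 0%N).
Proof.
apply/eqP/idP => [<-|ki]; first by rewrite /midx_succ upd_same.
by rewrite /midx_pred /midx_succ upd_same upd_upd prednK ?lt0n // upd_id.
Qed.

(** The finite boxes exhausting the slices over a finite set of base points. *)
Lemma slices_fset (i : 'I_n) (A : {fset I}) (N : nat) :
  {B : {fset I} | (B =i [pred k | (upd i 0 k \in A) && (k i < N)%N]) &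
    forall (V : zmodType) (c : I -> V), \sum_(k <- B) c k =
      \sum_(k <- A | (k : I) i == 0%N) \sum_(m < N) c (upd i m k)}.
Proof.
pose s := [seq upd i m k | k <- [seq k : I <- A | k i == 0%N], m <- iota 0 N].
have us : uniq s.
  apply: allpairs_uniq; rewrite ?filter_uniq ?fset_uniq ?iota_uniq //.
  move=> [k m] [k' m'] /allpairsP[[a b] /= [+ _ [-> ->]]] /allpairsP[[a' b'] /= [+ _ [-> ->]]] /=.
  rewrite !mem_filter => /andP[/eqP a0 _] /andP[/eqP a0' _] e.
  have := congr1 (fun k : I => k i) e; rewrite !upd_same => ->.
  by have := congr1 (upd i 0%N) e; rewrite !upd_upd -{1}a0 -{1}a0' !upd_id => ->.
have [B Bs hB] := cid2 (fset_of_uniq us); exists B.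
  move=> k; rewrite Bs inE; apply/allpairsP/andP => [[[a m] /= [+ + ->]]|[kA kN]].
    rewrite mem_filter mem_iota upd_upd upd_same => /andP[/eqP a0 aA] mN.
    by rewrite -{1}a0 upd_id.
  exists (upd i 0%N k, k i) => /=; rewrite mem_filter upd_same eqxx kA mem_iota kN.
  by rewrite upd_upd upd_id.
move=> V c; rewrite hB big_allpairs_dep big_filter; apply: eq_bigr => k _.
by rewrite -(big_mkord xpredT (fun m => c (upd i m k))) /index_iota subn0.
Qed.

Lemma slices_cover (i : 'I_n) (J : {fset I}) : exists N, forall k, k \in J -> (k i < N)%N.
Proof.
exists (\max_(k <- J) k i).+1 => k kJ; rewrite ltnS.
by apply: (@leq_bigmax_seq _ _ xpredT (fun k : I => k i)).
Qed.

(** Fubini, in the form: if the whole family has the sum [s], then so does the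
    family of its slice sums, placed at the base points [k i = 0]. For a finite
    set of base points, boxes of growing height over it have sums close to [s]
    and converging to the sum of the slice sums. *)
Lemma has_sum_slices (K : numFieldType) (V : normedModType K) (i : 'I_n)
    (c t : I -> V) (s : V) : has_sum c s ->
  (forall k, k i = 0%N -> (fun N => \sum_(m < N) c (upd i m k)) @ \oo --> t k) ->
  (forall k, k i != 0%N -> t k = 0) ->
  has_sum t s.
Proof.
move=> /has_sumP cs ct t0; apply/has_sumP => e e0.
have e2 : 0 < e / 2 by rewrite divr_gt0.
have [J0 hJ0] := cs _ e2; exists (upd i 0%N @` J0)%fset => A /fsubsetP J0A.
pose f N := \sum_(k <- A | (k : I) i == 0%N) \sum_(m < N) c (upd i m k).
have ft : f @ \oo --> \sum_(k <- A) t k.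
  rewrite (_ : \sum_(k <- A) t k = \sum_(k <- A | (k : I) i == 0%N) t k); last first.
    rewrite [RHS]big_mkcond /=; apply: eq_bigr => k _.
    by case: eqP => // /eqP /t0.
  by apply: cvg_sum_seq => k /eqP; exact: ct.
have [N0 hN0] := slices_cover i J0.
have [N1 _ hN1] : \forall N \near \oo, `|\sum_(k <- A) t k - f N| < e / 2.
  by move/cvgrPdist_lt: ft; apply.
pose N := maxn N0 N1; have [B Bm hB] := slices_fset i A N.
rewrite -(subrK (f N) s) -addrA [e]splitr.
apply: le_lt_trans (ler_normD _ _) (ltrD _ _).
  rewrite /f -hB; apply: hJ0; apply/fsubsetP => k kJ; rewrite Bm inE J0A /=.
    by apply: leq_trans (hN0 k kJ) (leq_maxl _ _).
  by apply/imfsetP; exists k.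
by rewrite distrC; apply: hN1; rewrite /= leq_maxr.
Qed.

(** The converse direction for nonnegative terms: bounds [B] for the slice sums
    that add up to at most [M] bound the whole sum. *)
Lemma sums_le_slices (K : numFieldType) (i : 'I_n) (b B : I -> K) (M : K) :
  (forall k, 0 <= b k) -> (forall k, 0 <= B k) ->
  (forall k N, k i = 0%N -> \sum_(m < N) b (upd i m k) <= B k) ->
  sums_le B M -> sums_le b M.
Proof.
move=> b0 B0 hb hB J; have [N hN] := slices_cover i J.
have [A Am hA] := slices_fset i (upd i 0%N @` J)%fset N.
apply: (@le_trans _ _ (\sum_(k <- A) b k)).
  apply: ler_sum_fset => //; apply/fsubsetP => k kJ; rewrite Am inE hN // andbT.
  by apply/imfsetP; exists k.
rewrite hA; apply: le_trans (hB (upd i 0%N @` J)%fset).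
rewrite [leRHS](bigID (fun k : I => k i == 0%N)) /=.
apply: ler_wpDr; first exact: sumr_ge0.
by apply: ler_sum => k /eqP k0; exact: hb.
Qed.

Lemma slices_sums_le (K : numFieldType) (i : 'I_n) (b : I -> K) (M : K) (A : {fset I}) N :
  sums_le b M -> \sum_(k <- A | (k : I) i == 0%N) \sum_(m < N) b (upd i m k) <= M.
Proof. by move=> bM; have [B _ <-] := slices_fset i A N. Qed.

Lemma slice_sums_le (K : numFieldType) (i : 'I_n) (b : I -> K) (M : K) k N :
  sums_le b M -> \sum_(m < N) b (upd i m k) <= M.
Proof.
move=> /(@slices_sums_le _ i _ _ [fset upd i 0%N k]%fset N).
rewrite big_mkcond big_seq_fset1 upd_same eqxx.
by under eq_bigr do rewrite upd_upd.
Qed.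
End MultiIndex.

(** * Power series with bounded coefficients *)

Section PowerSeries.
Context (R : realType) (H : completeNormedModType R[i]) (n : nat).
Local Notation C := (R[i]).
Local Notation I := {ffun 'I_n -> nat}.
Implicit Types (a b : I -> H) (z : polydisc R n) (k : I) (i : 'I_n).

Lemma coord_lt1 z i : `|\val z i| < 1.
Proof. by have := set_valP z; apply. Qed.

Lemma polydisc_of (w : 'I_n -> C) : (forall i, `|w i| < 1) ->
  {z : polydisc R n | \val z = w}.
Proof. by move=> h; exists (SigSub (mem_set h : w \in polydisc R n)). Qed.

(** The value of the sum of all [`|z ^ k|]. *)
Definition geometric_bound (w : 'I_n -> C) : C := \prod_(i < n) (1 - `|w i|)^-1.

Lemma geometric_le (x : C) N : 0 <= x -> x < 1 -> \sum_(m < N) x ^+ m <= (1 - x)^-1.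
Proof.
move=> x0 x1; have h : 0 < 1 - x by rewrite subr_gt0.
rewrite -[leRHS]mul1r ler_pdivlMr // mulrC -opprB mulNr -subrX1 opprB.
by rewrite gerBl exprn_ge0.
Qed.

(** A finite set of multi-indices lies in a cube, over which the sum is a product
    of finite geometric sums. *)
Lemma monomial_sums_le z : sums_le (fun k => `|monomial k z|) (geometric_bound (\val z)).
Proof.
move=> J; pose N := (\max_(k <- J) \max_(i < n) k i).+1.
pose toI (f : {ffun 'I_n -> 'I_N}) : I := [ffun i => f i : nat].
have toI_inj : injective toI.
  by move=> f g /ffunP e; apply/ffunP => i; apply: val_inj; have := e i; rewrite !ffunE.
have us : uniq [seq toI f | f <- enum {: {ffun 'I_n -> 'I_N}}].
  by rewrite map_inj_uniq ?enum_uniq.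
have [A Am hA] := fset_of_uniq us.
apply: (@le_trans _ _ (\sum_(k <- A) `|monomial k z|)).
  apply: ler_sum_fset => //; apply/fsubsetP => k kJ; rewrite Am.
  have kN i : (k i < N)%N.
    rewrite ltnS; apply: leq_trans (@leq_bigmax _ (fun i => k i) i) _.
    exact: (@leq_bigmax_seq _ _ xpredT (fun k : I => \max_(i < n) k i)).
  apply/mapP; exists [ffun i => Ordinal (kN i)]; first by rewrite mem_enum.
  by apply/ffunP => i; rewrite !ffunE.
rewrite hA big_map big_enum /=.
have -> : \sum_f `|monomial (toI f) z| = \prod_(i < n) \sum_(m < N) `|\val z i| ^+ m.
  rewrite bigA_distr_bigA; apply: eq_bigr => f _; rewrite /monomial normr_prod.
  by apply: eq_bigr => i _; rewrite normrX ffunE.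
by apply: ler_prod => i _; rewrite geometric_le ?coord_lt1 ?sumr_ge0.
Qed.

(** Boundedness suffices for the convergence of the power series. It has to be
    allowed because the states of the recursions below are bounded, but not
    square summable. *)
Definition bounded_family a (B : C) := forall k, `|a k| <= B.

Definition hsum a z : H := summability.sum (fun k => monomial k z *: a k).

Lemma bounded_family_ge0 a B : bounded_family a B -> 0 <= B.
Proof. by move=> /(_ [ffun=> 0%N]); apply: le_trans. Qed.

Lemma series_sums_le a B z : bounded_family a B ->
  sums_le (fun k => `|monomial k z *: a k|) (B * geometric_bound (\val z)).
Proof.
move=> aB; apply: (@le_sums_le _ _ _ (fun k => B * `|monomial k z|)).
  by move=> k; rewrite normrZ mulrC ler_wpM2r.
by apply: sums_leZ; [exact: bounded_family_ge0 aB|exact: monomial_sums_le].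
Qed.

Lemma hsumP a B z : bounded_family a B -> has_sum (fun k => monomial k z *: a k) (hsum a z).
Proof.
move=> /(series_sums_le z)/has_sum_abs[s hs].
by rewrite /hsum (has_sum_sum hs).
Qed.

Lemma has_sum_norm (V : normedModType C) (J : choiceType) (c : J -> V) (s : V) (M : C) :
  has_sum c s -> sums_le (fun l => `|c l|) M -> `|s| <= M.
Proof.
move=> /has_sumP h cM; apply/ler_addgt0Pl => e /h[J0 /(_ J0 (fsubset_refl _)) hJ].
rewrite -(subrK (\sum_(l <- J0) c l) s); apply: le_trans (ler_normD _ _) (lerD (ltW hJ) _).
by apply: le_trans (ler_norm_sum _ _ _) (cM J0).
Qed.

Lemma hsum_norm a B z : bounded_family a B -> `|hsum a z| <= B * geometric_bound (\val z).
Proof.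
by move=> aB; apply: has_sum_norm (hsumP z aB) (series_sums_le z aB).
Qed.

Lemma hsum_eq a B z s : bounded_family a B ->
  has_sum (fun k => monomial k z *: a k) s -> hsum a z = s.
Proof. by move=> aB; apply: has_sum_uniq (hsumP z aB). Qed.

Lemma hsumD a b A B z : bounded_family a A -> bounded_family b B ->
  hsum (fun k => a k + b k) z = hsum a z + hsum b z.
Proof.
move=> ha hb; apply: has_sum_sum.
under eq_fun do rewrite scalerDr; apply: has_sumD; [exact: hsumP ha|exact: hsumP hb].
Qed.

Lemma hsumZ c a A z : bounded_family a A -> hsum (fun k => c *: a k) z = c *: hsum a z.
Proof.
move=> ha; apply: has_sum_sum.
under eq_fun do rewrite scalerA mulrC -scalerA; apply: has_sumZ; exact: hsumP ha.
Qed.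

Lemma hsum_map (T : H -> H) a A z : lcontr T -> bounded_family a A ->
  hsum (fun k => T (a k)) z = T (hsum a z).
Proof.
move=> hT ha; apply: has_sum_sum; constructor; 
have <- : T \o partial_sum (fun k => monomial k z *: a k) =
    partial_sum (fun k => monomial k z *: T (a k)).
  apply/funext => J; rewrite /comp !partial_sumE (lc_sum hT).
  by apply: eq_bigr => k _; rewrite (lcZ hT).
exact: (lc_cvg hT (has_sum_cvg (hsumP z ha))).
Qed.

Lemma bounded_familyD a b A B : bounded_family a A -> bounded_family b B ->
  bounded_family (fun k => a k + b k) (A + B).
Proof. by move=> ha hb k; apply: le_trans (ler_normD _ _) (lerD (ha k) (hb k)). Qed.

Lemma bounded_family_map T a A : lcontr T -> bounded_family a A ->
  bounded_family (fun k => T (a k)) A.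
Proof. by move=> hT ha k; apply: le_trans (lc_norm hT _) (ha k). Qed.

Lemma bounded_familyZ c a A : bounded_family a A -> bounded_family (fun k => c *: a k) (`|c| * A).
Proof. by move=> ha k; rewrite normrZ ler_wpM2l. Qed.

Lemma bounded_familyB a b A B : bounded_family a A -> bounded_family b B ->
  bounded_family (fun k => a k - b k) (A + B).
Proof. by move=> ha hb k; apply: le_trans (ler_normB _ _) (lerD (ha k) (hb k)). Qed.

Lemma hsumB a b A B z : bounded_family a A -> bounded_family b B ->
  hsum (fun k => a k - b k) z = hsum a z - hsum b z.
Proof.
move=> ha hb; apply: has_sum_sum.
under eq_fun do rewrite scalerBr; apply: has_sumB; [exact: hsumP ha|exact: hsumP hb].
Qed.

(** The coefficients after multiplication by the [i]-th coordinate. *)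
Definition fshift i a k : H := if k i == 0%N then 0 else a (midx_pred i k).

Lemma bounded_fshift i a A : bounded_family a A -> bounded_family (fshift i a) A.
Proof.
by move=> ha k; rewrite /fshift; case: eqP => // _; rewrite normr0; exact: bounded_family_ge0 ha.
Qed.

Lemma monomial_succ i k z : monomial (midx_succ i k) z = \val z i * monomial k z.
Proof.
rewrite /monomial (bigD1 i) //= [X in _ = _ * X](bigD1 i) //= upd_same exprS mulrA.
by congr (_ * _); apply: eq_bigr => j ji; rewrite upd_other.
Qed.

Lemma hsum_shift i a A z : bounded_family a A -> hsum (fshift i a) z = \val z i *: hsum a z.
Proof.
move=> ha; apply: has_sum_sum; have := has_sum_inj (@succK n i) (has_sumZ (\val z i) (hsumP z ha)).
rewrite (_ : (fun k => monomial k z *: fshift i a k) = fun k =>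
  if midx_succ i (midx_pred i k) == k then \val z i *: (monomial (midx_pred i k) z *: a (midx_pred i k)) else 0) //.
apply/funext => k; rewrite /fshift; case: ifP => [/eqP k0|k0]; first by rewrite succ_pred k0 scaler0.
rewrite succ_pred k0 /= scalerA -monomial_succ (eqP (_ : midx_succ i _ == k)) //.
by rewrite succ_pred k0.
Qed.

Lemma hsum_restrict i a A z z' : bounded_family a A ->
  \val z' = (fun j => if j == i then 0 else \val z j) ->
  hsum (fun k => if k i == 0%N then a k else 0) z = hsum a z'.
Proof.
move=> ha zz'; apply: has_sum_sum; have := hsumP z' ha.
rewrite (_ : (fun k => monomial k z' *: a k) =
  (fun k => monomial k z *: (if k i == 0%N then a k else 0))) //.
apply/funext => k; case: ifP => [/eqP k0|k0].
  congr (_ *: _); apply: eq_bigr => j _; rewrite zz'; case: eqP => // ->.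
  by rewrite k0 !expr0.
rewrite scaler0 /monomial (bigD1 i) //= zz' eqxx expr0n k0 /= mul0r scale0r //.
Qed.

(** [f = f (z_i := 0) + z_i g], where the coefficients of [g] are those of [f]
    shifted down in direction [i]. *)
Lemma hsum_split i a A z z' : bounded_family a A ->
  \val z' = (fun j => if j == i then 0 else \val z j) ->
  hsum a z = hsum a z' + \val z i *: hsum (fun k => a (midx_succ i k)) z.
Proof.
move=> ha zz'.
have hs : bounded_family (fun k => a (midx_succ i k)) A by move=> k; apply: ha.
have hr : bounded_family (fun k => if k i == 0%N then a k else 0) A.
  by move=> k; case: eqP => // _; rewrite normr0; exact: bounded_family_ge0 ha.
rewrite -(hsum_shift i z hs) -(hsum_restrict ha zz').
rewrite -(hsumD z hr (bounded_fshift i hs)); congr (hsum _ z).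
apply/funext => k; rewrite /fshift; case: ifP => [k0|k0]; first by rewrite addr0.
by rewrite add0r (eqP (_ : midx_succ i _ == k)) // succ_pred k0.
Qed.

(** The function [g] of the preceding splitting vanishes with [f]: immediately
    where [z_i] is not 0, and elsewhere because splitting [g] itself shows that
    its value at [z_i = 0] differs from one at [z_i = t] by at most a multiple of
    [t], uniformly for [t] up to 1/2. *)
Lemma hsum_succ0 i a A : bounded_family a A -> (forall z, hsum a z = 0) ->
  forall z, hsum (fun k => a (midx_succ i k)) z = 0.
Proof.
move=> ha a0 z.
pose b k := a (midx_succ i k); have hb : bounded_family b A by move=> k; apply: ha.
have nz (y : polydisc R n) : \val y i != 0 -> hsum b y = 0.
  move=> yi; have [|y' hy'] := @polydisc_of (fun j => if j == i then 0 else \val y j).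
    by move=> j; case: eqP => _; rewrite ?normr0 ?ltr01 ?coord_lt1.
  have := hsum_split ha hy'; rewrite !a0 add0r => /esym/eqP.
  by rewrite scaler_eq0 (negPf yi) => /eqP.
rewrite -/b; have [zi|] := eqVneq (\val z i) 0; last exact: nz.
pose w (t : C) j := if j == i then t else \val z j.
pose G := geometric_bound (w (1 / 2)).
have G0 : 0 <= G.
  apply: prodr_ge0 => j _; rewrite invr_ge0 subr_ge0 /w; case: eqP => _; last by rewrite ltW ?coord_lt1.
  rewrite ger0_norm ?divr_ge0 // ler_pdivrMr // mul1r; exact: ler1n.
have A0 := bounded_family_ge0 ha.
apply/eqP; rewrite -normr_le0.
apply/ler_addgt0Pl => e e0; rewrite addr0.
(* this t is at most 1 / 2, and t (A G) is at most e *)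
pose t := (e / (A * G + 1)) / (1 + 2 * (e / (A * G + 1))).
set q := e / (A * G + 1) in t.
have p1 : 0 < A * G + 1 by rewrite ltr_wpDl ?mulr_ge0.
have q0 : 0 < q by rewrite divr_gt0.
have d0 : 0 < 1 + 2 * q by exact: (addr_gt0 ltr01 (mulr_gt0 (ltr0Sn _ 1) q0)).
have t0 : 0 < t by rewrite divr_gt0.
have t2 : t <= 1 / 2.
  rewrite /t ler_pdivrMr // (_ : 1 / 2 * (1 + 2 * q) = q + 1 / 2); last by field.
  by rewrite lerDl divr_ge0.
have tq : t * (A * G) <= e.
  apply: (@le_trans _ _ (q * (A * G + 1))); last by rewrite /q divfK // gt_eqF.
  apply: ler_pM; [exact: ltW|exact: mulr_ge0| |by rewrite lerDl].
  rewrite /t ler_pdivrMr // mulrDr mulr1 lerDl; apply: mulr_ge0 (ltW q0) _.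
  exact: mulr_ge0 (ler0n _ 2) (ltW q0).
have [|y hy] := @polydisc_of (w t).
  move=> j; rewrite /w; case: eqP => _; last exact: coord_lt1.
  rewrite gtr0_norm //; apply: le_lt_trans t2 _.
  by rewrite ltr_pdivrMr // mul1r ltr1n.
have zy : \val z = (fun j => if j == i then 0 else \val y j).
  by apply/funext => j; rewrite hy /w; case: eqP => [->|].
have := hsum_split hb zy; rewrite (nz y) ?hy /w ?eqxx ?gt_eqF // => /esym/eqP.
rewrite addr_eq0 => /eqP ->; rewrite normrN normrZ gtr0_norm //; apply: le_trans tq.
rewrite ler_wpM2l ?(ltW t0) //.
have hs : bounded_family (fun k => b (midx_succ i k)) A by move=> k; apply: hb.
apply: le_trans (hsum_norm y hs) _; rewrite ler_wpM2l //.
apply: ler_prod => j _; rewrite invr_ge0 subr_ge0 ltW ?coord_lt1 //=.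
rewrite hy /w; case: eqP => // _.
have h2 : (0 : C) < 1 - `|1 / 2|.
  by rewrite subr_gt0 ger0_norm ?divr_ge0 // ltr_pdivrMr // mul1r ltr1n.
rewrite lef_pV2 ?posrE //; last first.
  by rewrite gtr0_norm // subr_gt0; apply: le_lt_trans t2 _; rewrite ltr_pdivrMr // mul1r ltr1n.
by rewrite lerD2l lerN2 gtr0_norm // ger0_norm ?divr_ge0.
Qed.

(** Induction on the total degree of [k]: the constant coefficient is the value
    at 0, and the other ones are coefficients of lower degree of a shifted
    family. *)
Lemma hsum_inj0 a A : bounded_family a A -> (forall z, hsum a z = 0) -> forall k, a k = 0.
Proof.
move=> ha a0 k; have [d] := ubnP (\sum_i k i)%N; elim: d => // d IH in a k ha a0 *.
rewrite ltnS => kd; have [[i ki]|k0] := pselect (exists i, k i != 0%N).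
  rewrite -(eqP (_ : midx_succ i (midx_pred i k) == k)); last by rewrite succ_pred.
  apply: (IH (fun k => a (midx_succ i k))); [by move=> ?; apply: ha|exact: hsum_succ0 ha a0|].
  apply: leq_trans kd; rewrite (bigD1 i) //= [leqRHS](bigD1 i) //= upd_same.
  rewrite (eq_bigr (fun j => k j)); first by rewrite ltn_add2r prednK ?lt0n.
  by move=> j ji; rewrite upd_other.
have {}k0 : k = [ffun=> 0%N].
  by apply/ffunP => i; rewrite ffunE; apply/eqP/negPn/negP => ki; apply: k0; exists i.
have [|z hz] := @polydisc_of (fun=> 0); first by move=> i; rewrite normr0.
rewrite -(a0 z); apply/esym; rewrite (hsum_eq ha (s := monomial k z *: a k)).
  by rewrite k0 /monomial big1 ?scale1r // => i _; rewrite ffunE.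
apply: has_sum_single => k' kk'.
have [i ki] : exists i, k' i != 0%N.
  apply/existsP; apply: contraNT kk'; rewrite negb_exists => /forallP h.
  by apply/eqP/ffunP => i; rewrite k0 ffunE; apply/eqP; have := h i; rewrite negbK.
by rewrite /monomial (bigD1 i) //= hz expr0n (negPf ki) mul0r scale0r.
Qed.

Lemma hsum_inj a b A B : bounded_family a A -> bounded_family b B -> hsum a = hsum b -> a = b.
Proof.
move=> ha hb e; apply/funext => k; apply/subr0_eq.
apply: (hsum_inj0 (bounded_familyB ha hb)) => z.
by rewrite (hsumB z ha hb) e subrr.
Qed.
End PowerSeries.

(** * Square summable families and the inner product of the Hardy space *)

Section SquareSummable.
Context (R : realType) (H : completeNormedModType R[i]) (dot : {dot H for Num.conj}).
Hypothesis hdot : forall x, dot x x = `|x| ^+ 2.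
Context (n : nat).
Local Notation C := (R[i]).
Local Notation I := {ffun 'I_n -> nat}.
Implicit Types (a b c : I -> H).

Definition l2 a := exists M : C, sums_le (fun k => `|a k| ^+ 2) M.

Lemma norm_le_1Dsqr (x : H) (M : C) : `|x| ^+ 2 <= M -> `|x| <= 1 + M.
Proof.
move=> xM; apply: le_trans (_ : 1 + `|x| ^+ 2 <= _); last by rewrite lerD2l.
rewrite -subr_ge0.
have -> : 1 + `|x| ^+ 2 - `|x| = (`|x| - 2^-1) ^+ 2 + 3 / 4 by field.
apply: addr_ge0; last by rewrite divr_ge0.
by apply: real_exprn_even_ge0 => //; rewrite rpredB ?normr_real // ger0_real ?invr_ge0.
Qed.

Lemma l2_bounded a : l2 a -> exists B, bounded_family a B.
Proof.
by move=> [M hM]; exists (1 + M) => k; apply: norm_le_1Dsqr; exact: (sums_le_point k hM).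
Qed.

Lemma hardy_seriesP (f : polydisc R n -> H) a : hardy_series f a <-> l2 a /\ f = hsum a.
Proof.
split=> [[[M hM] hf]|[[M hM] ->]].
  split; first by exists M => J; rewrite -partial_sumE.
  by apply/funext => z; rewrite /hsum (has_sum_sum (HasSum (hf z))).
split; first by exists M => J; rewrite partial_sumE.
move=> z; have [B hB] : exists B, bounded_family a B by apply: l2_bounded; exists M.
exact: has_sum_cvg (hsumP z hB).
Qed.

Lemma hsum_inj_l2 a b : l2 a -> l2 b -> hsum a = hsum b :> (polydisc R n -> H) -> a = b.
Proof. by move=> /l2_bounded[A hA] /l2_bounded[B hB]; exact: hsum_inj hA hB. Qed.

Lemma hardy_coefE a : l2 a -> hardy_coef (hsum a : polydisc R n -> H) = a.
Proof.
move=> ha; rewrite /hardy_coef; set P := [set _ | _].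
have : P (xget (fun=> 0) P) by apply: xgetPex; exists a; apply/hardy_seriesP.
by move=> /hardy_seriesP[h /esym]; exact: hsum_inj_l2.
Qed.

Lemma hardyP (E : set H) (f : polydisc R n -> H) :
  hardy E f <-> exists2 a, (forall k, E (a k)) & l2 a /\ f = hsum a.
Proof. by split=> [[a Ea /hardy_seriesP h]|[a Ea h]]; exists a => //; apply/hardy_seriesP. Qed.

Lemma l2Z (t : C) a : l2 a -> l2 (fun k => t *: a k).
Proof.
move=> [M hM]; exists (`|t| ^+ 2 * M).
apply: le_sums_le (sums_leZ (exprn_ge0 2 (normr_ge0 t)) hM) => k.
by rewrite normrZ exprMn.
Qed.

Lemma l2D a b : l2 a -> l2 b -> l2 (fun k => a k + b k).
Proof.
move=> [M hM] [N hN]; exists (2 * M + 2 * N).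
apply: le_sums_le (sums_leD (sums_leZ (ler0n _ 2) hM) (sums_leZ (ler0n _ 2) hN)) => k.
have /= := exprn_ge0 2 (normr_ge0 (a k - b k)); rewrite -!hdot !(dotBl, dotBr, dotDl, dotDr) => h.
rewrite -subr_ge0; apply: le_trans h _; rewrite le_eqVlt; apply/orP; left; apply/eqP; ring.
Qed.

Lemma l2B a b : l2 a -> l2 b -> l2 (fun k => a k - b k).
Proof.
move=> ha hb; have := l2D ha (l2Z (-1) hb).
by under eq_fun do rewrite scaleN1r.
Qed.

Definition ldot a b : C := summability.sum (fun k => dot (a k) (b k) : C^o).

Lemma l2_norm_sum a : l2 a -> exists2 s : C,
  has_sum (fun k => dot (a k) (a k) : C^o) (s : C^o) & sums_le (fun k => `|a k| ^+ 2) s.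
Proof.
move=> [M hM]; have [|s hs sM] := has_sum_nonneg _ hM; first by move=> k; exact: exprn_ge0.
by exists s => //; under eq_fun do rewrite hdot.
Qed.

(** By polarization, from the convergence of sums of squares. *)
Lemma ldotP a b : l2 a -> l2 b -> has_sum (fun k => dot (a k) (b k) : C^o) (ldot a b : C^o).
Proof.
move=> ha hb.
have hp (t : C) : exists s : C, has_sum (fun k => dot (a k + t *: b k) (a k + t *: b k) : C^o) (s : C^o).
  by have [s hs _] := l2_norm_sum (l2D ha (l2Z t hb)); exists s.
have [s1 h1] := hp 1; have [s2 h2] := hp (-1).
have [s3 h3] := hp 'i%R; have [s4 h4] := hp (- 'i%R).
have h := has_sumZ (4^-1 : C) (has_sumD (has_sumB h1 h2) (has_sumZ 'i%R (has_sumB h3 h4))).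
suff e : (fun k => dot (a k) (b k)) = (fun k => 4^-1 * (dot (a k + 1 *: b k) (a k + 1 *: b k) -
    dot (a k + (-1) *: b k) (a k + (-1) *: b k) +
    'i%R * (dot (a k + 'i%R *: b k) (a k + 'i%R *: b k) -
            dot (a k + (- 'i%R) *: b k) (a k + (- 'i%R) *: b k)))).
  by rewrite /ldot e (has_sum_sum h).
apply/funext => k; rewrite !(dotDl, dotDr, dotZl, dotZr) !rmorphN /= !rmorph1 !conjCi.
set x := dot (a k) (a k); set y := dot (a k) (b k).
set z := dot (b k) (a k); set w := dot (b k) (b k).
have i2 : ('i%R : C) ^+ 2 = -1 by exact: sqrCi.
transitivity (4^-1 * (2 * y * (1 - 'i%R ^+ 2) + 2 * z * (1 + 'i%R ^+ 2)) : C).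
  by rewrite i2; field.
by ring.
Qed.

Lemma ldot_eq a b (s : C) : l2 a -> l2 b ->
  has_sum (fun k => dot (a k) (b k) : C^o) (s : C^o) -> ldot a b = s.
Proof. by move=> ha hb; apply: has_sum_uniq (ldotP ha hb). Qed.

Lemma hardy_dotE a b : l2 a -> l2 b ->
  hardy_dot dot (hsum a : polydisc R n -> H) (hsum b) = ldot a b.
Proof. by move=> ha hb; rewrite /hardy_dot !hardy_coefE. Qed.

Lemma ldotDl a b c : l2 a -> l2 b -> l2 c ->
  ldot (fun k => a k + b k) c = ldot a c + ldot b c.
Proof.
move=> ha hb hc; apply: ldot_eq => //; first exact: l2D.
by under eq_fun do rewrite dotDl; apply: has_sumD; exact: ldotP.
Qed.

Lemma ldotZl (t : C) a b : l2 a -> l2 b -> ldot (fun k => t *: a k) b = t * ldot a b.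
Proof.
move=> ha hb; apply: ldot_eq => //; first exact: l2Z.
by under eq_fun do rewrite dotZl; apply: has_sumZ; exact: ldotP.
Qed.

Lemma ldotC a b : l2 a -> l2 b -> ldot a b = Num.conj (ldot b a).
Proof.
move=> ha hb; apply: ldot_eq => //; apply/has_sumP => e.
have /has_sumP h := ldotP hb ha; move=> /h[J0 hJ]; exists J0 => J /hJ.
rewrite -norm_conjC rmorphB rmorph_sum /=.
by under eq_bigr do rewrite -dotC.
Qed.

Lemma ldot_ge0 a : l2 a -> sums_le (fun k => `|a k| ^+ 2) (ldot a a).
Proof. by move=> ha; have [s hs h] := l2_norm_sum ha; rewrite (ldot_eq ha ha hs). Qed.

Lemma ldot_eq0 a : l2 a -> ldot a a = 0 -> forall k, a k = 0.
Proof.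
move=> ha a0 k; have := sums_le_point k (ldot_ge0 ha); rewrite a0 => h.
by apply/eqP; rewrite -normr_eq0 -sqrf_eq0 eq_le h exprn_ge0.
Qed.
End SquareSummable.

Section Slices.
Context (R : realType) (n : nat).
Local Notation C := (R[i]).
Local Notation I := {ffun 'I_n -> nat}.
Implicit Types k : I.

Lemma nonneg_series_sup (b : nat -> C) (M : C) : (forall m, 0 <= b m) ->
  (forall N, \sum_(m < N) b m <= M) -> exists2 s : C,
  (forall N, \sum_(m < N) b m <= s) & (fun N => \sum_(m < N) b m : C^o) @ \oo --> (s : C^o).
Proof.
move=> b0 bM; pose E := [set x : C | exists N, x = \sum_(m < N) b m].
have [|x [J ->]|s [sub sadh]] := @csup R E M; first by exists 0, 0%N; rewrite big_ord0.
  by rewrite bM sumr_ge0.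
exists s => [N|]; first by apply: sub; exists N.
apply/cvgrPdist_lt => e e0; have [_ [N ->] hN] := sadh e e0; exists N => // m /= Nm.
rewrite ger0_norm; last by rewrite subr_ge0; apply: sub; exists m.
rewrite ltrBlDr addrC; apply: lt_le_trans hN _; rewrite lerD2r.
by rewrite -(subnK Nm) addnC big_split_ord /= lerDl sumr_ge0.
Qed.

(** [L k] is the limit of the partial sums over the slice through [k]; finite sums
    of these limits are limits of sums over boxes, hence at most [M]. Such an [L]
    provides the bounds asked for in [sums_le_slices]. *)
Lemma slice_totals (i : 'I_n) (b : I -> C) (M : C) : (forall k, 0 <= b k) -> sums_le b M ->
  exists L : I -> C, [/\ forall k, 0 <= L k,
    forall k N, k i = 0%N -> \sum_(m < N) b (upd i m k) <= L k & sums_le L M].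
Proof.
move=> b0 bM.
have /choice[L hL] (k : I) : exists s : C, (forall N, \sum_(m < N) b (upd i m k) <= s) /\
    (fun N => \sum_(m < N) b (upd i m k) : C^o) @ \oo --> (s : C^o).
  have [//|N|s h1 h2] := @nonneg_series_sup (fun m => b (upd i m k)) M; last by exists s.
  exact: slice_sums_le.
exists (fun k => if k i == 0%N then L k else 0); split=> [k|k N ->|A].
- by case: eqP => // _; have := (hL k).1 0%N; rewrite big_ord0.
- exact: (hL k).1.
pose f (B : {fset I}) N := \sum_(k <- B | (k : I) i == 0%N) \sum_(m < N) b (upd i m k).
apply: (@cvg_le_cst _ (f A)); rewrite /f.
  rewrite -big_mkcond /=; apply: (@cvg_sum_seq C C^o _ _ _ (fun k N => \sum_(m < N) b (upd i m k))).
  by move=> k _; exact: (hL k).2.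
by move=> N; exact: slices_sums_le.
Qed.
End Slices.

(** * The unitary colligation of a contraction *)

Section Colligation.
Context (R : realType) (H : completeNormedModType R[i]) (dot : {dot H for Num.conj}).
Hypothesis hdot : forall x, dot x x = `|x| ^+ 2.
Local Notation C := (R[i]).
Variable T : H -> H.
Hypothesis hT : lcontr T.
Local Notation Ts := (hadjoint dot T).
Local Notation D := (defect dot T).
Local Notation Ds := (defect_adj dot T).
Let hTs : lcontr Ts := hadjoint_lcontr hdot hT.
Let hD : lcontr D := defect_lcontr hdot hT.
Let hDs : lcontr Ds := defect_adj_lcontr hdot hT.
Let TTs : adjoint_pair dot T Ts := hadjointP hdot hT.
Let TsT : adjoint_pair dot Ts T := adjoint_pairC TTs.

(** The inverse of the colligation with rows [(Ts, D)] and [(Ds, - T)] is its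
    adjoint, with rows [(T, Ds)] and [(D, - Ts)]; both are isometric. *)
Lemma colligation_energy x y :
  `|T x + Ds y| ^+ 2 + `|D x - Ts y| ^+ 2 = `|x| ^+ 2 + `|y| ^+ 2.
Proof.
rewrite -!hdot !(dotBl, dotBr, dotDl, dotDr).
rewrite !(defect_sym hdot hT, defect_adj_sym hdot hT) (defectK hdot hT) (defect_adjK hdot hT).
rewrite !TTs !TsT !dotBr (defect_adj_intertwine hdot hT) (defect_intertwine hdot hT).
by ring.
Qed.

Lemma defect_adj_energy x : `|Ds x| ^+ 2 = `|x| ^+ 2 - `|Ts x| ^+ 2.
Proof.
by rewrite -!hdot (defect_adj_sym hdot hT) (defect_adjK hdot hT) dotBr TsT.
Qed.

Lemma colligation_inv x y : let u := D x - Ts y in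
  x = Ts (T x + Ds y) + D u /\ y = Ds (T x + Ds y) - T u.
Proof.
move=> u; rewrite /u (lcB hD) (lcB hT) (lcD hTs) (lcD hDs).
rewrite (defectK hdot hT) (defect_adjK hdot hT) (defect_adj_intertwine hdot hT).
rewrite (defect_intertwine hdot hT); split.
  by rewrite addrACA subrr addr0 addrCA subrr addr0.
by rewrite opprB addrA -(addrA _ _ (T _)) subrK addrC addKr.
Qed.

Definition obs_sum (v : nat -> H) (N : nat) := \sum_(m < N) iter m T (Ds (v m)).
(** The adjoint of the map sending [x] to the free response [(Ds (Ts ^ m x))_m]. *)
Definition obs (v : nat -> H) : H := limn (obs_sum v).

Lemma lcontr_iter m : lcontr (iter m T).
Proof.
elim: m => [|m IH]; first by split=> // x /=.
by have := lcontr_comp hT IH.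
Qed.

Lemma obs_sumS v N : obs_sum v N.+1 = Ds (v 0%N) + T (obs_sum (v \o succn) N).
Proof. by rewrite /obs_sum big_ord_recl (lc_sum hT). Qed.

(** Horner's scheme evaluates the sum by steps [x |-> T x + Ds y], each of which
    gains at most the energy of [y]. *)
Lemma obs_sum_norm v N : `|obs_sum v N| ^+ 2 <= \sum_(m < N) `|v m| ^+ 2.
Proof.
elim: N v => [|N IH] v; first by rewrite /obs_sum !big_ord0 normr0 expr0n.
rewrite obs_sumS big_ord_recl addrC [leRHS]addrC.
apply: le_trans (lerD (IH (v \o succn)) (lexx _)).
by rewrite -colligation_energy lerDl exprn_ge0.
Qed.

Lemma obs_sumD v N m : obs_sum v (N + m) = obs_sum v N + iter N T (obs_sum (fun j => v (N + j)%N) m).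
Proof.
rewrite /obs_sum big_split_ord /= (lc_sum (lcontr_iter N)); congr (_ + _).
by apply: eq_bigr => j _; rewrite -iterD.
Qed.

Section Observability.
Variables (v : nat -> H) (M : C).
Hypothesis vM : forall N, \sum_(m < N) `|v m| ^+ 2 <= M.

Lemma obs_cvg : obs_sum v @ \oo --> obs v.
Proof.
apply: cvgn_of_cauchy => e e0.
have [N hN] := @series_tail _ (fun m => `|v m| ^+ 2) _ (fun m => exprn_ge0 2 (normr_ge0 (v m))) vM _ (exprn_gt0 2 e0).
exists N => m Nm; rewrite distrC -(@ltr_pXn2r _ 2) ?nnegrE // ?ltW //.
apply: le_lt_trans (hN m Nm); rewrite -(subnKC Nm) obs_sumD addrC addKr big_split_ord /=.
rewrite addrAC subrr add0r; apply: le_trans (lc_norm2 (lcontr_iter N) _) _.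
exact: obs_sum_norm.
Qed.

Lemma obs_norm : `|obs v| ^+ 2 <= M.
Proof.
apply: (@cvg_le_cst _ (fun N => `|obs_sum v N| ^+ 2)).
  have h : (fun N => `|obs_sum v N| : C^o) @ \oo --> (`|obs v| : C^o).
    exact: cvg_norm obs_cvg.
  exact: (@cvgZ C C^o nat \oo _ _ _ _ _ h h).
by move=> N; apply: le_trans (obs_sum_norm _ _) (vM N).
Qed.
End Observability.

Lemma obs_rec (v : nat -> H) (M : C) : (forall N, \sum_(m < N) `|v m| ^+ 2 <= M) ->
  obs v = Ds (v 0%N) + T (obs (v \o succn)).
Proof.
move=> vM; have vM' N : \sum_(m < N) `|(v \o succn) m| ^+ 2 <= M.
  by apply: le_trans (vM N.+1); rewrite big_ord_recl lerDr exprn_ge0.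
apply: (@cvg_uniq _ H nat \oo _ (fun N => obs_sum v N.+1)).
  by have := obs_cvg vM; rewrite -(cvg_shiftS (obs_sum v)).
under eq_fun do rewrite obs_sumS.
by apply: cvgD; [exact: cvg_cst|apply: (lc_cvg hT); exact: obs_cvg vM'].
Qed.

(** Telescoping; for [T] of class C_.0 this makes the free response isometric. *)
Lemma observability_sum N x :
  \sum_(m < N) `|Ds (iter m Ts x)| ^+ 2 = `|x| ^+ 2 - `|iter N Ts x| ^+ 2.
Proof.
elim: N => [|N IH]; first by rewrite big_ord0 subrr.
rewrite big_ord_recr /= IH defect_adj_energy; ring.
Qed.
End Colligation.

(** * Closures of ranges *)

Section ClosedRange.
Context (R : realType) (H : completeNormedModType R[i]).
Local Notation C := (R[i]).

Lemma closureP (S : set H) x :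
  closure S x <-> forall e : C, 0 < e -> exists2 y, S y & `|x - y| < e.
Proof.
split=> [h e e0|h B /nbhs_ballP[e e0 eB]].
  have [y [Sy]] := h _ (nbhsx_ballx x e e0).
  by rewrite -ball_normE /=; exists y.
by have [y Sy xy] := h e e0; exists y; split=> //; apply: eB; rewrite -ball_normE.
Qed.

Variables (A : H -> H).
Hypothesis hA : lcontr A.
Local Notation E := (closure (range A)).

Lemma range_sub_closure x : E (A x).
Proof. by apply: subset_closure; exists x. Qed.

Lemma closed_range0 : E 0.
Proof. by rewrite -(lc0 hA); exact: range_sub_closure. Qed.

Lemma closed_rangeD x y : E x -> E y -> E (x + y).
Proof.
move=> /closureP Ex /closureP Ey; apply/closureP => e e0.
have e2 : 0 < e / 2 by rewrite divr_gt0.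
have [_ [x' _ <-] hx] := Ex _ e2; have [_ [y' _ <-] hy] := Ey _ e2.
exists (A (x' + y')); first by exists (x' + y').
rewrite (lcD hA) opprD addrACA [e]splitr.
exact: le_lt_trans (ler_normD _ _) (ltrD hx hy).
Qed.

Lemma closed_range_lin (c : C) x y : E x -> E y -> E (c *: x + y).
Proof.
move=> Ex; apply: closed_rangeD; apply/closureP => e e0.
have p : 0 < `|c| + 1 by rewrite ltr_wpDl.
have /closureP/(_ _ (divr_gt0 e0 p))[_ [w _ <-]] := Ex.
rewrite ltr_pdivlMr // => h; exists (A (c *: w)); first by exists (c *: w).
rewrite (lcZ hA) -scalerBr normrZ mulrC; apply: le_lt_trans h.
by rewrite ler_wpM2l // lerDl.
Qed.

Lemma closed_range_lim (I : Type) (F : set_system I) (FF : ProperFilter F) (u : I -> H) l :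
  u @ F --> l -> (forall t, E (u t)) -> E l.
Proof.
move=> /cvgrPdist_lt ul Eu; apply/closureP => e e0.
have e2 : 0 < e / 2 by rewrite divr_gt0.
have [t ht] := filter_ex (ul _ e2); have /closureP/(_ _ e2)[w Aw hw] := Eu t.
exists w => //; rewrite -(subrK (u t) l) -addrA [e]splitr.
exact: le_lt_trans (ler_normD _ _) (ltrD ht hw).
Qed.

Lemma closed_range_map (B A' : H -> H) x : lcontr B ->
  (forall y, closure (range A') (B (A y))) -> E x -> closure (range A') (B x).
Proof.
move=> hB hBA /closureP Ex; apply/closureP => e e0.
have e2 : 0 < e / 2 by rewrite divr_gt0.
have [_ [y _ <-] hx] := Ex _ e2.
have /closureP/(_ _ e2)[w Aw hw] := hBA y; exists w => //.
rewrite -(subrK (B (A y)) (B x)) -addrA [e]splitr.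
apply: le_lt_trans (ler_normD _ _) (ltrD _ hw).
by rewrite -(lcB hB); apply: le_lt_trans (lc_norm hB _) hx.
Qed.
End ClosedRange.

Lemma closed_rangeB (R : realType) (H : completeNormedModType R[i]) (A : H -> H) x y :
  lcontr A -> closure (range A) x -> closure (range A) y -> closure (range A) (x - y).
Proof. by move=> hA Ex Ey; rewrite addrC -scaleN1r; exact: closed_range_lin. Qed.

(** * The colligation along one variable *)

Section MultiColligation.
Context (R : realType) (H : completeNormedModType R[i]) (dot : {dot H for Num.conj}).
Hypothesis hdot : forall x, dot x x = `|x| ^+ 2.
Local Notation C := (R[i]).
Variable T : H -> H.
Hypothesis hT : lcontr T.
Local Notation Ts := (hadjoint dot T).
Local Notation D := (defect dot T).
Local Notation Ds := (defect_adj dot T).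
Let hTs : lcontr Ts := hadjoint_lcontr hdot hT.
Let hD : lcontr D := defect_lcontr hdot hT.
Let hDs : lcontr Ds := defect_adj_lcontr hdot hT.
Context (n : nat) (i : 'I_n).
Local Notation I := {ffun 'I_n -> nat}.
Implicit Types (a u x : I -> H) (k : I).

(** The state recursion says [X = z_i (Ts X + D U)] for the generating functions
    [X] of the states and [U] of the inputs, which determines [X] as the value
    of the resolvent occurring in the characteristic function. *)
Lemma char_mult_transfer u x A B (z : polydisc R n) :
  bounded_family u A -> bounded_family x B ->
  (forall k, k i = 0%N -> x k = 0) ->
  (forall k, x (midx_succ i k) = Ts (x k) + D (u k)) ->
  char_fun dot T (\val z i) (hsum u z) = hsum (fun k => Ds (x k) - T (u k)) z.
Proof.
move=> hu hx x0 xS.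
have hTx := bounded_family_map hTs hx; have hDu := bounded_family_map hD hu.
have hDx := bounded_family_map hDs hx; have hTu := bounded_family_map hT hu.
rewrite (hsumB z hDx hTu) (hsum_map z hDs hx) (hsum_map z hT hu) /char_fun addrC.
congr (Ds _ - _).
have X : hsum x z - \val z i *: Ts (hsum x z) = \val z i *: D (hsum u z).
  have E : hsum x z = \val z i *: (Ts (hsum x z) + D (hsum u z)).
    rewrite -(hsum_map z hTs hx) -(hsum_map z hD hu) -(hsumD z hTx hDu).
    rewrite -(hsum_shift i z (bounded_familyD hTx hDu)).
    congr (hsum _ z); apply/funext => k; rewrite /fshift; case: ifP => [/eqP/x0//|k0].
    by rewrite -xS (eqP (_ : midx_succ i _ == k)) // succ_pred k0.
  by rewrite {1}E scalerDr addrC addKr.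
rewrite -X; have inj : {in setT &, injective (fun y => y - \val z i *: Ts y)}.
  move=> y1 y2 _ _ e; apply: subr0_eq; apply/eqP; rewrite -normr_eq0.
  have {}e : y1 - y2 = \val z i *: Ts (y1 - y2).
    apply: subr0_eq; rewrite (lcB hTs) scalerBr.
    transitivity ((y1 - \val z i *: Ts y1) - (y2 - \val z i *: Ts y2)); last by rewrite e subrr.
    by rewrite !opprB addrACA [RHS]addrACA; congr (_ + _); exact: addrC.
  have : `|y1 - y2| <= `|\val z i| * `|y1 - y2|.
    by rewrite {1}e normrZ ler_wpM2l // (lc_norm hTs).
  rewrite -subr_le0 (_ : `|y1 - y2| - _ = (1 - `|\val z i|) * `|y1 - y2|); last by ring.
  rewrite pmulr_rle0 ?subr_gt0 ?coord_lt1 //.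
  by rewrite normr_le0 => /eqP->; rewrite normr0.
by apply: (pinvKV (fun=> 0) inj); rewrite inE.
Qed.

(** The backward recursion: the states and inputs producing the outputs [a].
    [proj_free] is the response to the initial states alone; for [T] of class
    C_.0 it is the projection of [a] onto the orthogonal complement of the range
    of the characteristic function. *)
Definition state a k : H := obs dot T (fun m => a (upd i (k i + m) k)).
Definition input a k : H := D (state a (midx_succ i k)) - Ts (a k).
Definition proj_free a k : H := Ds (iter (k i) Ts (state a (upd i 0%N k))).

Section Backward.
Variables (a : I -> H) (M : C).
Hypothesis aM : sums_le (fun k => `|a k| ^+ 2) M.

Let tail_le k N : \sum_(m < N) `|a (upd i (k i + m) k)| ^+ 2 <= M.
Proof.
apply: le_trans (slice_sums_le i k (k i + N) aM).
by rewrite big_split_ord /= lerDr sumr_ge0 // => m _; exact: exprn_ge0.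
Qed.

Lemma state_rec k : T (state a (midx_succ i k)) + Ds (a k) = state a k.
Proof.
rewrite /state (obs_rec hdot hT (tail_le k)) addn0 upd_id addrC; congr (_ + T (obs _ _ _)).
by apply/funext => m /=; rewrite /midx_succ upd_same upd_upd addSnnS.
Qed.

Lemma state_succ k : state a (midx_succ i k) = Ts (state a k) + D (input a k).
Proof.
by rewrite /input -(state_rec k); case: (colligation_inv hdot hT (state a (midx_succ i k)) (a k)).
Qed.

Lemma output_eq k : a k = Ds (state a k) - T (input a k).
Proof.
by rewrite /input -(state_rec k); case: (colligation_inv hdot hT (state a (midx_succ i k)) (a k)).
Qed.

Lemma input_energy k :
  `|input a k| ^+ 2 = `|state a (midx_succ i k)| ^+ 2 + `|a k| ^+ 2 - `|state a k| ^+ 2.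
Proof. by rewrite -(colligation_energy hdot hT) state_rec addrC addKr. Qed.

Lemma state_norm k : `|state a k| ^+ 2 <= M.
Proof. exact: (obs_norm hdot hT (tail_le k)). Qed.

(** The state at height [N] only depends on the part of the slice above [N]. *)
Lemma state_tail k (L : C) N : k i = 0%N ->
  (forall N, \sum_(m < N) `|a (upd i m k)| ^+ 2 <= L) ->
  `|state a (upd i N k)| ^+ 2 + \sum_(m < N) `|a (upd i m k)| ^+ 2 <= L.
Proof.
move=> k0 hL; rewrite -lerBrDr; apply: (obs_norm hdot hT) => N'.
rewrite lerBrDr addrC; apply: le_trans (hL (N + N')%N).
rewrite big_split_ord /= lerD2l ler_sum // => m _.
by rewrite upd_same upd_upd.
Qed.

Lemma input_slice k N : k i = 0%N -> \sum_(m < N) `|input a (upd i m k)| ^+ 2 =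
  `|state a (upd i N k)| ^+ 2 + \sum_(m < N) `|a (upd i m k)| ^+ 2 - `|state a k| ^+ 2.
Proof.
move=> k0; elim: N => [|N IH]; first by rewrite !big_ord0 -{1}k0 upd_id addr0 subrr.
rewrite !big_ord_recr /= IH input_energy /midx_succ upd_same upd_upd.
by ring.
Qed.

(** On a slice, the energy of the inputs is the energy of the outputs plus that
    of the final state minus that of the initial state. *)
Lemma input_sums_le : sums_le (fun k => `|input a k| ^+ 2) M.
Proof.
have [L [L0 hL LM]] := slice_totals i (fun k => exprn_ge0 2 (normr_ge0 (a k))) aM.
apply: (sums_le_slices (i := i)) L0 _ LM => [k|k N k0]; first exact: exprn_ge0.
rewrite input_slice //; apply: le_trans (state_tail N k0 (fun N => hL k N k0)).
by rewrite gerBl exprn_ge0.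
Qed.

Let state_le_total k (L : C) : k i = 0%N ->
  (forall N, \sum_(m < N) `|a (upd i m k)| ^+ 2 <= L) -> `|state a k| ^+ 2 <= L.
Proof.
by move=> k0 hL; have := state_tail 0 k0 hL; rewrite big_ord0 addr0 -{1}k0 upd_id.
Qed.

Lemma state0_sums_le : sums_le (fun k => `|if k i == 0%N then state a k else 0| ^+ 2) M.
Proof.
have [L [L0 hL LM]] := slice_totals i (fun k => exprn_ge0 2 (normr_ge0 (a k))) aM.
apply: le_sums_le LM => k; case: eqP => [k0|_]; last by rewrite normr0 expr0n.
by apply: state_le_total => // N; exact: hL.
Qed.

Lemma proj_free_sums_le : sums_le (fun k => `|proj_free a k| ^+ 2) M.
Proof.
have [L [L0 hL LM]] := slice_totals i (fun k => exprn_ge0 2 (normr_ge0 (a k))) aM.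
apply: (sums_le_slices (i := i)) L0 _ LM => [k|k N k0]; first exact: exprn_ge0.
apply: le_trans (state_le_total k0 (fun N => hL k N k0)).
have kE : upd i 0%N k = k by rewrite -k0 upd_id.
under eq_bigr do rewrite /proj_free upd_same upd_upd kE.
by rewrite (observability_sum hdot hT) gerBl exprn_ge0.
Qed.

(** Subtracting from the states the free evolution of the initial states gives
    states that start from 0, with the same inputs. *)
Lemma char_mult_input (z : polydisc R n) :
  char_fun dot T (\val z i) (hsum (input a) z) = hsum (fun k => a k - proj_free a k) z.
Proof.
pose x k := state a k - iter (k i) Ts (state a (upd i 0%N k)).
have [B hB] : exists B, bounded_family (input a) B by apply: l2_bounded; exists M; exact: input_sums_le.
have hs k : `|state a k| <= 1 + M by exact/norm_le_1Dsqr/state_norm.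
have hx : bounded_family x ((1 + M) + (1 + M)).
  move=> k; apply: le_trans (ler_normB _ _) (lerD (hs _) _).
  by apply: le_trans (lc_norm (lcontr_iter hTs _) _) (hs _).
rewrite (char_mult_transfer z hB hx).
- congr (hsum _ z); apply/funext => k; rewrite [in RHS]output_eq /x (lcB hDs).
  by rewrite addrAC.
- move=> k k0; have kE : upd i 0%N k = k by rewrite -k0 upd_id.
  by rewrite /x k0 kE subrr.
- move=> k; rewrite /x state_succ /midx_succ upd_same upd_upd /= (lcB hTs).
  by rewrite addrAC.
Qed.
End Backward.

Fixpoint forward_state (v : nat -> H) (m : nat) : H :=
  if m is l.+1 then Ts (forward_state v l) + D (v l) else 0.

Lemma forward_energy (x u : H) :
  `|Ts x + D u| ^+ 2 + `|Ds x - T u| ^+ 2 = `|x| ^+ 2 + `|u| ^+ 2.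
Proof.
have TTs : adjoint_pair dot T Ts := hadjointP hdot hT.
have TsT : adjoint_pair dot Ts T := adjoint_pairC TTs.
rewrite -!hdot !(dotBl, dotBr, dotDl, dotDr).
rewrite !(defect_sym hdot hT, defect_adj_sym hdot hT) (defectK hdot hT) (defect_adjK hdot hT).
rewrite !TTs !TsT !dotBr (defect_adj_intertwine hdot hT) (defect_intertwine hdot hT).
by ring.
Qed.

Lemma forward_state_norm v N : `|forward_state v N| ^+ 2 <= \sum_(m < N) `|v m| ^+ 2.
Proof.
elim: N => [|N IH] /=; first by rewrite big_ord0 normr0 expr0n.
rewrite big_ord_recr /=; apply: le_trans (lerD IH (lexx _)).
by rewrite -forward_energy lerDl exprn_ge0.
Qed.

(** The forward recursion from initial states 0. *)
Definition forward u k : H := forward_state (fun m => u (upd i m k)) (k i).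
Definition output u k : H := Ds (forward u k) - T (u k).

Lemma forward_upd u m k :
  forward u (upd i m k) = forward_state (fun j => u (upd i j k)) m.
Proof.
rewrite /forward upd_same; congr (forward_state _ m).
by apply/funext => j; rewrite upd_upd.
Qed.

Section Forward.
Variables (u : I -> H) (M : C).
Hypothesis uM : sums_le (fun k => `|u k| ^+ 2) M.

Lemma forward_norm k : `|forward u k| ^+ 2 <= M.
Proof. exact: le_trans (forward_state_norm _ _) (slice_sums_le i k (k i) uM). Qed.

Lemma forward_bounded : bounded_family (forward u) (1 + M).
Proof. by move=> k; exact/norm_le_1Dsqr/forward_norm. Qed.

Let u_bounded : bounded_family u (1 + M).
Proof. by move=> k; apply/norm_le_1Dsqr/(sums_le_point k uM). Qed.

Lemma output_bounded : bounded_family (output u) ((1 + M) + (1 + M)).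
Proof.
apply: bounded_familyB; [exact: bounded_family_map forward_bounded|].
exact: bounded_family_map u_bounded.
Qed.

Lemma char_mult_output (z : polydisc R n) :
  char_fun dot T (\val z i) (hsum u z) = hsum (output u) z.
Proof.
apply: char_mult_transfer u_bounded forward_bounded _ _ => [k k0|k].
  by rewrite /forward k0.
by rewrite /midx_succ forward_upd /= upd_id.
Qed.

(** The outputs satisfy [Ds y_m = x_m - T x_(m+1)], so the partial sums telescope
    to [- dot x_N (Ts ^ N r)], where [x_N] is bounded and [Ts ^ N r] tends to 0. *)
Lemma output_orthogonal r k : class_C_dot_0 dot T ->
  (fun N => \sum_(m < N) dot (output u (upd i m k)) (Ds (iter m Ts r)) : C^o) @ \oo --> (0 : C^o).
Proof.
move=> /(_ r) Tr; pose x m := forward_state (fun j => u (upd i j k)) m.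
have E N : \sum_(m < N) dot (output u (upd i m k)) (Ds (iter m Ts r)) = - dot (x N) (iter N Ts r).
  elim: N => [|N IH]; first by rewrite big_ord0 dot0l oppr0.
  rewrite big_ord_recr /= IH -(defect_adj_sym hdot hT) /output forward_upd -/(x N).
  rewrite (lcB hDs) (defect_adjK hdot hT) -(defect_intertwine hdot hT).
  have -> : x N - T (Ts (x N)) - T (D (u (upd i N k))) = x N - T (x N.+1).
    by rewrite /= (lcD hT) opprD addrA.
  by rewrite dotBl (hadjointP hdot hT) addKr.
under eq_fun do rewrite E.
apply/cvgrPdist_lt => e e0.
have M1 : 0 < 1 + M by rewrite ltr_pwDl // (sums_le_ge0 uM).
have e1 : 0 < e / (1 + M) by rewrite divr_gt0.
move/cvgrPdist_lt/(_ _ e1): Tr; apply: filterS => N.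
rewrite sub0r normrN opprK add0r ltr_pdivlMr // => h.
apply: le_lt_trans (cauchy_schwarz hdot _ _) _; apply: le_lt_trans h.
rewrite mulrC ler_wpM2l // /x; apply/norm_le_1Dsqr.
exact: le_trans (forward_state_norm _ _) (slice_sums_le i k N uM).
Qed.
End Forward.

Lemma input_in_defect_space a : (forall k, closure (range Ds) (a k)) ->
  forall k, defect_space dot T (input a k).
Proof.
move=> ha k; apply: closed_rangeB => //; first exact: range_sub_closure.
apply: (closed_range_map hTs) (ha k) => y.
by rewrite (defect_adj_intertwine hdot hT); exact: range_sub_closure.
Qed.

(** [proj_free a] is a limit of sums of vectors [Ds Ts^p T^q Ds] applied to
    coefficients of [a]. *)
Lemma proj_free_in_closed_range (A : H -> H) (a : I -> H) : l2 a -> lcontr A ->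
  (forall p q y, closure (range A) (Ds (iter p Ts (iter q T (Ds (A y)))))) ->
  (forall k, closure (range A) (a k)) -> forall k, closure (range A) (proj_free a k).
Proof.
move=> [M aM] hA hE ha k; pose v m := a (upd i m k).
have hB : lcontr (fun y : H => Ds (iter (k i) Ts y)).
  exact: lcontr_comp hDs (lcontr_iter hTs _).
have vM N : \sum_(m < N) `|v m| ^+ 2 <= M by exact: (slice_sums_le i k N aM).
have -> : proj_free a k = Ds (iter (k i) Ts (obs dot T v)).
  rewrite /proj_free /state upd_same; congr (Ds (iter _ _ (obs _ _ _))).
  by apply/funext => m; rewrite upd_upd.
pose B := fun y : H => Ds (iter (k i) Ts y).
have hl : B \o obs_sum dot T v @ \oo --> B (obs dot T v).
  by apply: (lc_cvg hB); exact: obs_cvg vM.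
apply: (@closed_range_lim _ _ A _ _ _ _ _ hl) => N; rewrite {hl}/B.
rewrite /= /obs_sum (lc_sum hB); elim: N => [|N IH].
  by rewrite big_ord0; exact: closed_range0.
rewrite big_ord_recr; apply: closed_rangeD => //.
have hC : lcontr (fun y : H => Ds (iter (k i) Ts (iter N T (Ds y)))).
  by apply: (lcontr_comp hB); exact: lcontr_comp (lcontr_iter hT _) hDs.
exact: (closed_range_map hC) (ha _).
Qed.

End MultiColligation.

(** * Ordered products *)

Section OrderedProduct.
Context (J : eqType) (X : Type).
Implicit Types (F G : J -> X -> X) (s : seq J).

(** Products of maps that commute only for different indices, so that the order
    of the factors has to be kept track of. *)
Definition oprod F s x := foldr F x s.

Lemma oprod_big F s x : (\big[(fun f g => f \o g)/idfun]_(i <- s) F i) x = oprod F s x.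
Proof. by elim: s x => [|i s IH] x; rewrite ?big_nil // big_cons /= IH. Qed.

Lemma oprod_comm (A : X -> X) F s x :
  (forall j y, j \in s -> A (F j y) = F j (A y)) -> A (oprod F s x) = oprod F s (A x).
Proof.
elim: s => //= j s IH h; rewrite h ?mem_head // IH // => l y ls.
by apply: h; rewrite in_cons ls orbT.
Qed.

Lemma oprod_extract F s i x : i \in s ->
  (forall j l y, j != l -> F j (F l y) = F l (F j y)) ->
  oprod F s x = F i (oprod F (rem i s) x).
Proof.
move=> + Fc; elim: s => //= j s IH; rewrite in_cons; have [->//|ji /= is_] := eqVneq i j.
by rewrite IH // Fc // eq_sym.
Qed.

(** A factor [G j] moves past [F l] for all [l] different from [j], which is
    possible because [j] does not occur later in [s]. *)
Lemma oprod_mul F G s x : uniq s ->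
  (forall j l y, j != l -> G j (F l y) = F l (G j y)) ->
  oprod (fun j y => F j (G j y)) s x = oprod F s (oprod G s x).
Proof.
move=> + FG; elim: s => //= j s IH /andP[js us]; rewrite IH // (oprod_comm (A := G j)) // => l y ls.
by apply: FG; apply: contraNneq js => ->.
Qed.

Lemma eq_oprod F G s x : (forall j y, j \in s -> F j y = G j y) -> oprod F s x = oprod G s x.
Proof.
elim: s => //= j s IH h; rewrite h ?mem_head // IH // => l y ls.
by apply: h; rewrite in_cons ls orbT.
Qed.
End OrderedProduct.

(** * The dilation and the decomposition of the model space *)

Section Model.
Context (R : realType) (H : completeNormedModType R[i]) (dot : {dot H for Num.conj}).
Hypothesis hdot : forall x, dot x x = `|x| ^+ 2.
Context (n : nat) (T : 'I_n -> H -> H).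
Local Notation C := (R[i]).
Local Notation I := {ffun 'I_n -> nat}.
Local Notation Ts i := (hadjoint dot (T i)).
Local Notation Ds i := (defect_adj dot (T i)).
Implicit Types (a b u w : I -> H) (k : I) (s : seq 'I_n) (x y : H).
Hypothesis hT : forall i, lcontr (T i).
Hypothesis TT : forall i j x, i != j -> T i (T j x) = T j (T i x).
Hypothesis TTadj : forall i j x, i != j -> T i (Ts j x) = Ts j (T i x).
Hypothesis pure : forall i, class_C_dot_0 dot (T i).

Let hTs i : lcontr (Ts i) := hadjoint_lcontr hdot (hT i).
Let hDs i : lcontr (Ds i) := defect_adj_lcontr hdot (hT i).
Let adjP i : adjoint_pair dot (T i) (Ts i) := hadjointP hdot (hT i).

Let TsTs i j x : i != j -> Ts i (Ts j x) = Ts j (Ts i x).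
Proof.
move=> ij; apply: (dot_injr hdot) => z; rewrite -!adjP TT // eq_sym //.
Qed.
Let TsT i j x : i != j -> Ts i (T j x) = T j (Ts i x).
Proof. by move=> ij; rewrite TTadj // eq_sym. Qed.

Let TDs i j x : i != j -> T i (Ds j x) = Ds j (T i x).
Proof. by move=> ij; apply: defect_adj_comm => // y; [rewrite TT|rewrite TTadj]. Qed.
Let TsDs i j x : i != j -> Ts i (Ds j x) = Ds j (Ts i x).
Proof. by move=> ij; apply: defect_adj_comm => // y; [rewrite TsT|rewrite TsTs]. Qed.
Let DsDs i j x : i != j -> Ds i (Ds j x) = Ds j (Ds i x).
Proof.
move=> ij; have ji : j != i by rewrite eq_sym.
by apply: defect_adj_comm => // y; [rewrite -TDs|rewrite -TsDs].
Qed.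

Let iter_comm (A B : H -> H) m : (forall y, A (B y) = B (A y)) ->
  forall y, A (iter m B y) = iter m B (A y).
Proof. by move=> AB y; elim: m => //= m IH; rewrite AB IH. Qed.

Definition coef_op i m x : H := Ds i (iter m (Ts i) x).

Let coef_lcontr i m : lcontr (coef_op i m).
Proof. exact: lcontr_comp (hDs i) (lcontr_iter (hTs i) m). Qed.

Let coef_commT i j m x : i != j -> T i (coef_op j m x) = coef_op j m (T i x).
Proof.
by move=> ij; rewrite /coef_op TDs // (iter_comm m (fun y => TTadj y ij)).
Qed.
Let coef_commTs i j m x : i != j -> Ts i (coef_op j m x) = coef_op j m (Ts i x).
Proof.
by move=> ij; rewrite /coef_op TsDs // (iter_comm m (fun y => TsTs y ij)).
Qed.
Let coef_commDs i j m x : i != j -> Ds i (coef_op j m x) = coef_op j m (Ds i x).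
Proof.
move=> ij; rewrite /coef_op DsDs // (iter_comm m (fun y => _)) // => y.
by rewrite TsDs // eq_sym.
Qed.
Let coef_comm i j m l x : i != j -> coef_op i m (coef_op j l x) = coef_op j l (coef_op i m x).
Proof.
move=> ij; rewrite {1 4}/coef_op -coef_commDs //; congr (Ds i _).
by elim: m => //= m ->; rewrite coef_commTs.
Qed.

(** The coefficients of the dilation of the operators with indices in [s]. *)
Definition mcoef s k x : H := oprod (fun i => coef_op i (k i)) s x.

Lemma mcoef_lcontr s k : lcontr (mcoef s k).
Proof.
elim: s => [|i s IH]; first by split=> // x /=.
exact: lcontr_comp (coef_lcontr i (k i)) IH.
Qed.

Lemma mcoef_upd s i m k x : i \notin s -> mcoef s (upd i m k) x = mcoef s k x.
Proof.
move=> is_; apply: eq_oprod => j y js; rewrite upd_other //.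
by apply: contraNneq is_ => <-.
Qed.

Lemma mcoef_extract s i k x : uniq s -> i \in s ->
  mcoef s k x = coef_op i (k i) (mcoef (rem i s) k x).
Proof.
by move=> us si; rewrite /mcoef (oprod_extract _ si) // => j l y jl; exact: coef_comm.
Qed.

Lemma mcoef_comm (A : H -> H) s k x :
  (forall j m y, j \in s -> A (coef_op j m y) = coef_op j m (A y)) ->
  A (mcoef s k x) = mcoef s k (A x).
Proof. by move=> h; apply: oprod_comm => j y js; exact: h. Qed.

Local Notation es := (index_enum 'I_n).
Let us_es : uniq es := index_enum_uniq _.
Let mem_es i : i \in es := mem_index_enum i.
Local Notation DT := (joint_defect_adj dot T).
Local Notation E := (joint_defect_adj_space dot T).

Let DTE x : DT x = oprod (fun i => Ds i) es x.
Proof. by rewrite /joint_defect_adj oprod_big. Qed.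

Lemma joint_defect_adj_lcontr : lcontr DT.
Proof.
have -> : DT = (fun x => oprod (fun i => Ds i) es x) by apply/funext => x; exact: DTE.
elim: es => [|i s IH]; first by split=> // x /=.
exact: lcontr_comp (hDs i) IH.
Qed.

Let hDT := joint_defect_adj_lcontr.

Lemma mcoef_in_E k x : E (mcoef es k x).
Proof.
rewrite /mcoef (oprod_mul (F := fun i => Ds i) (G := fun i => iter (k i) (Ts i))) //.
  by rewrite -DTE; exact: range_sub_closure.
move=> j l y jl; apply/esym; apply: iter_comm => {}y.
by rewrite TsDs.
Qed.

(** [joint_defect_adj] is [Ds i] times a product [Rest] that commutes with [T i],
    [Ts i] and [Ds i]. Pulled to the left, [Rest] meets the leftmost [Ds i] and
    forms [joint_defect_adj] again. *)
Lemma proj_free_op_E i p q y : E (Ds i (iter p (Ts i) (iter q (T i) (Ds i (DT y))))).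
Proof.
pose Rest x := oprod (fun j => Ds j) (rem i es) x.
have DTi x : DT x = Ds i (Rest x).
  by rewrite DTE (oprod_extract _ (mem_es i)) // => j l v jl; exact: DsDs.
have Rc (A : H -> H) x : (forall j y, j != i -> A (Ds j y) = Ds j (A y)) ->
    A (Rest x) = Rest (A x).
  move=> h; apply: oprod_comm => j v; rewrite rem_filter // mem_filter => /andP[ji _].
  exact: h.
pose z := iter p (Ts i) (iter q (T i) (Ds i (Ds i y))).
suff -> : Ds i (iter p (Ts i) (iter q (T i) (Ds i (DT y)))) = DT z by exact: range_sub_closure.
rewrite !DTi; congr (Ds i _).
rewrite (Rc (fun v : H => iter p (Ts i) (iter q (T i) (Ds i (Ds i v))))) // => j v ji.
have ij : i != j by rewrite eq_sym.
rewrite (DsDs v ij) (DsDs (Ds i v) ij).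
rewrite -(iter_comm q (A := Ds j)); last by move=> v1; rewrite TDs.
by rewrite -(iter_comm p (A := Ds j)) // => v1; rewrite TsDs.
Qed.

Definition model_coef x k : H := mcoef es k x.

Lemma model_coef_succ x i k : model_coef x (midx_succ i k) = model_coef (Ts i x) k.
Proof.
rewrite /model_coef !(@mcoef_extract es i) // /midx_succ upd_same mcoef_upd; last first.
  by rewrite mem_rem_uniq // inE eqxx.
rewrite -mcoef_comm /coef_op ?iterSr // => j m y.
rewrite mem_rem_uniq // inE => /andP[ji _]; apply: coef_commTs.
by rewrite eq_sym.
Qed.

Let supp s k := [forall j, (k j != 0%N) ==> (j \in s)].

(** Induction on [s]: the slice sums in the direction of the new index [i] are
    those of [observability_sum], whose limits are the terms for [s]. *)
Lemma mcoef_isometry s x : uniq s ->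
  sums_le (fun k => if supp s k then `|mcoef s k x| ^+ 2 else 0) (`|x| ^+ 2) /\
  has_sum (fun k => (if supp s k then `|mcoef s k x| ^+ 2 else 0) : C^o) (`|x| ^+ 2 : C^o).
Proof.
elim: s => [_|i s IH /= /andP[is_ us]].
  pose c k : C := if supp [::] k then `|mcoef [::] k x| ^+ 2 else 0.
  have c0 : c [ffun=> 0%N] = `|x| ^+ 2.
    by rewrite /c ifT //; apply/forallP => j; rewrite ffunE.
  have hc : has_sum (c : _ -> C^o) (`|x| ^+ 2 : C^o).
    rewrite -c0; apply: (@has_sum_single _ C C^o c) => k k0; rewrite /c ifF //.
    apply: contraNF k0 => /forallP h; apply/eqP/ffunP => j; rewrite ffunE; apply/eqP.
    by have := h j; rewrite implybF negbK.
  split=> //; apply: has_sum_ub hc => k; rewrite /c; case: ifP => // _.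
have [tle tsum] := IH us.
pose t k : C := if supp s k then `|mcoef s k x| ^+ 2 else 0.
pose c k : C := if supp (i :: s) k then `|mcoef (i :: s) k x| ^+ 2 else 0.
have c0 k : 0 <= c k by rewrite /c; case: ifP => // _; exact: exprn_ge0.
have t0 k : 0 <= t k by rewrite /t; case: ifP => // _; exact: exprn_ge0.
have suppS k m : k i = 0%N -> supp (i :: s) (upd i m k) = supp s k.
  move=> k0; apply: eq_forallb => j; rewrite in_cons.
  have [->|ji] := eqVneq j i; first by rewrite k0 implybT.
  by rewrite upd_other.
have csum k N : k i = 0%N -> \sum_(m < N) c (upd i m k) =
    if supp s k then `|mcoef s k x| ^+ 2 - `|iter N (Ts i) (mcoef s k x)| ^+ 2 else 0.
  move=> k0; rewrite /c; under eq_bigr do rewrite suppS //.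
  case: ifP => _; last by rewrite big1.
  rewrite -(observability_sum hdot (hT i)); apply: eq_bigr => m _.
  by rewrite /mcoef /= upd_same -/(mcoef _ _ _) -/(mcoef s _ _) mcoef_upd.
have cle : sums_le c (`|x| ^+ 2).
  apply: (sums_le_slices (i := i) (B := t)) => // k N k0; rewrite csum // /t.
  by case: ifP => // _; rewrite gerBl exprn_ge0.
split=> //; have [sg csg _] := has_sum_nonneg c0 cle.
suff tsg : has_sum (t : _ -> C^o) (sg : C^o) by rewrite (has_sum_uniq tsum tsg).
apply: (has_sum_slices (i := i) csg) => k k0; last first.
  rewrite /t ifF //; apply: contraNF is_ => /forallP/(_ i); by rewrite k0.
under eq_fun do rewrite csum //.
rewrite /t; case: ifP => _; last exact: cvg_cst.
have h : (fun N => `|iter N (Ts i) (mcoef s k x)| : C^o) @ \oo --> (`|0 : H| : C^o).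
  by apply: cvg_norm; exact: (pure i).
have h0 : (fun N => `|iter N (Ts i) (mcoef s k x)| ^+ 2 : C^o) @ \oo --> (0 : C^o).
  rewrite normr0 in h; rewrite -(scaler0 C^o (0 : C)).
  exact: (@cvgZ C C^o nat \oo _ _ _ _ _ h h).
exact: (@cvg_subr0 C C^o _ _ h0).
Qed.

Lemma model_coef_sums_le x : sums_le (fun k => `|model_coef x k| ^+ 2) (`|x| ^+ 2).
Proof.
have [h _] := mcoef_isometry x us_es; apply: le_sums_le h => k.
by rewrite ifT //; apply/forallP => j; rewrite mem_es implybT.
Qed.

Lemma model_coef_l2 x : l2 (model_coef x).
Proof. by exists (`|x| ^+ 2); exact: model_coef_sums_le. Qed.

Lemma model_coef_norm x : ldot dot (model_coef x) (model_coef x) = dot x x.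
Proof.
apply: (ldot_eq hdot (model_coef_l2 x) (model_coef_l2 x)); rewrite hdot.
have [_ h] := mcoef_isometry x us_es.
suff -> : (fun k => dot (model_coef x k) (model_coef x k) : C^o) =
  (fun k => (if supp es k then `|mcoef es k x| ^+ 2 else 0) : C^o) by [].
apply/funext => k; rewrite hdot ifT //.
by apply/forallP => j; rewrite mem_es implybT.
Qed.

Lemma model_coef_lin c x y :
  model_coef (c *: x + y) = (fun k => c *: model_coef x k + model_coef y k).
Proof. by apply/funext => k; rewrite /model_coef (lcZD (mcoef_lcontr _ _)). Qed.

Lemma model_coef_dot x y : ldot dot (model_coef x) (model_coef y) = dot x y.
Proof.
apply: subr0_eq; have ul := model_coef_l2.
apply: (sesquilinear_diag0 (f := fun x y => ldot dot (model_coef x) (model_coef y) - dot x y)).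
- move=> c v w z; rewrite model_coef_lin (ldotDl hdot (l2Z c (ul v)) (ul w) (ul z)).
  by rewrite (ldotZl hdot c (ul v) (ul z)) dotDl dotZl; ring.
- move=> c v w z; rewrite (ldotC hdot (ul _) (ul _)) model_coef_lin.
  rewrite (ldotDl hdot (l2Z c (ul v)) (ul w) (ul z)) (ldotZl hdot c (ul v) (ul z)).
  rewrite rmorphD rmorphM /= -!(ldotC hdot (ul _) (ul _)) dotDr dotZr; ring.
- by move=> v; rewrite model_coef_norm subrr.
Qed.

Lemma l2_fshift i a : l2 a -> l2 (fshift i a).
Proof.
move=> [M aM]; have [s hs _] := has_sum_nonneg (fun k => exprn_ge0 2 (normr_ge0 (a k))) aM.
exists s; apply: has_sum_ub => [k|]; first exact: exprn_ge0.
have := has_sum_inj (@succK n i) hs.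
rewrite (_ : (fun k => if _ then _ else 0) = (fun k => `|fshift i a k| ^+ 2)) //.
apply/funext => k; rewrite /fshift succ_pred; case: eqP => //= _.
by rewrite normr0 expr0n.
Qed.

Lemma ldot_fshift i a b : l2 a -> l2 b -> l2 (fun k => b (midx_succ i k)) ->
  ldot dot (fshift i a) b = ldot dot a (fun k => b (midx_succ i k)).
Proof.
move=> ha hb hsb; apply: (ldot_eq hdot (l2_fshift i ha) hb).
have := has_sum_inj (@succK n i) (ldotP hdot ha hsb).
rewrite (_ : (fun k => if _ then _ else 0) = (fun k => dot (fshift i a k) (b k))) //.
apply/funext => k; rewrite /fshift; case: ifP => [k0|]; last first.
  by rewrite succ_pred => /negbFE ->; rewrite dot0l.
by move: (k0); rewrite succ_pred => /negPf ->; rewrite (eqP k0).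
Qed.

Lemma fshift_E i a : (forall k, E (a k)) -> forall k, E (fshift i a k).
Proof. by move=> ha k; rewrite /fshift; case: eqP => // _; exact: closed_range0. Qed.

Lemma mult_coord_hsum i a : l2 a ->
  mult_coord i (hsum a : polydisc R n -> H) = hsum (fshift i a).
Proof. by move=> /l2_bounded[B aB]; apply/funext => z; rewrite (hsum_shift i z aB). Qed.

(** The [i]-th summand in the definition of [S_T], in terms of coefficients. *)
Definition char_range i c := [/\ l2 c, forall k, E (c k) & exists u, [/\ l2 u,
  forall k, defect_space dot (T i) (u k) & forall z : polydisc R n,
    char_fun dot (T i) (\val z i) (hsum u z) = hsum c z]].

(** Along each slice in direction [i] the inner products sum up to 0. *)
Lemma char_range_orthogonal i c x : char_range i c -> ldot dot c (model_coef x) = 0.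
Proof.
move=> [hc _ [u [[M uM] _ huc]]].
have [B hB] := l2_bounded hc.
have cE : output dot (T i) i u = c.
  apply: (hsum_inj (output_bounded hdot (hT i) i uM) hB); apply/funext => z.
  by rewrite -(char_mult_output hdot (hT i) i uM).
apply: (has_sum_uniq (c := fun k => 0 : C^o)); last exact: has_sum0.
apply: (has_sum_slices (i := i) (ldotP hdot hc (model_coef_l2 x))) => // k k0.
have := @output_orthogonal _ _ _ hdot _ (hT i) _ i _ _ uM (mcoef (rem i es) k x) k (pure i).
rewrite cE (_ : (fun N => \sum_(m < N) dot (c (upd i m k)) (Ds i (iter m (Ts i) (mcoef (rem i es) k x)))) =
  (fun N => \sum_(m < N) dot (c (upd i m k)) (model_coef x (upd i m k)))) //.
apply/funext => N; apply: eq_bigr => m _; congr (dot _ _).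
rewrite /model_coef (mcoef_extract _ _ us_es (mem_es i)) upd_same mcoef_upd //.
by rewrite mem_rem_uniq // inE eqxx.
Qed.

Lemma obs_map i (A : H -> H) (v : nat -> H) (M : C) : lcontr A ->
  (forall y, A (T i y) = T i (A y)) -> (forall y, A (Ds i y) = Ds i (A y)) ->
  (forall N, \sum_(m < N) `|v m| ^+ 2 <= M) ->
  A (obs dot (T i) v) = obs dot (T i) (A \o v).
Proof.
move=> hA AT AD vM; apply: (@cvg_uniq _ H nat \oo _ (A \o obs_sum dot (T i) v)).
  by apply: (lc_cvg hA); exact: obs_cvg vM.
have -> : A \o obs_sum dot (T i) v = obs_sum dot (T i) (A \o v).
  apply/funext => N; rewrite /= /obs_sum (lc_sum hA); apply: eq_bigr => m _.
  by rewrite (iter_comm m AT) AD.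
apply: (obs_cvg hdot (hT i) (M := M)) => N; apply: le_trans (vM N).
by apply: ler_sum => m _; exact: lc_norm2.
Qed.

Definition zero_on s k : I := [ffun j => if j \in s then 0%N else k j].

(** Induction on [s]. Given the remainder [b] for [s], its part in the range of
    the next characteristic function is split off and [proj_free] of [b]
    remains. The operators [mcoef s k] commute with those of the index [i], so
    they come out of the series for the states; this turns the base values [w]
    of [b] into their own states [w'], located at [k i = 0]. *)
Lemma char_range_decomposition s a : uniq s -> l2 a -> (forall k, E (a k)) ->
  exists g : 'I_n -> I -> H, exists b, exists w,
  [/\ forall i, i \in s -> char_range i (g i),
      forall k, a k = \sum_(i <- s) g i k + b k,
      l2 b /\ (forall k, E (b k)), l2 w &
      forall k, b k = mcoef s k (w (zero_on s k))].
Proof.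
move=> + ha Ea; elim: s => [_|i s IH /= /andP[is_ us]].
  exists (fun=> a), a, a; split=> // k; first by rewrite big_nil add0r.
  by congr a; apply/ffunP => j; rewrite ffunE.
have [g [b [w [hg hab [hb Eb] [M wM] bE]]]] := IH us.
have [Mb bM] := hb.
pose p := proj_free dot (T i) i b.
have hp : l2 p by exists Mb; exact: proj_free_sums_le.
have Ep k : E (p k).
  by apply: (proj_free_in_closed_range hdot (hT i) hb hDT _ Eb) => *; exact: proj_free_op_E.
have hbp : l2 (fun k => b k - p k) by exact: (l2B hdot).
pose w' k := if k i == 0%N then state dot (T i) i w k else 0.
exists (fun j => if j == i then (fun k => b k - p k) else g j), p, w'; split.
- move=> j; rewrite in_cons; have [-> _|ji /= js] := eqVneq j i; last exact: hg.
  split=> // [k|]; first exact: (closed_rangeB hDT (Eb k) (Ep k)).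
  exists (input dot (T i) i b); split.
  + by exists Mb; exact: input_sums_le.
  + apply: input_in_defect_space => // k.
    have hid : lcontr (idfun : H -> H) by split.
    apply: (closed_range_map (A := DT) hid _ (Eb k)) => y /=.
    rewrite DTE (oprod_extract _ (mem_es i)); first exact: range_sub_closure.
    by move=> j1 j2 v jl; exact: DsDs.
  + by move=> z; exact: (char_mult_input hdot (hT i) i bM).
- move=> k; rewrite big_cons eqxx hab.
  rewrite [X in _ = _ + X + _](eq_big_seq (fun j => g j k)) /=.
    by rewrite [in RHS]addrAC subrK addrC.
  by move=> j js; rewrite ifN //; apply: contraNneq is_ => <-.
- by [].
- by exists M; exact: state0_sums_le.
- move=> k; rewrite /w' ffunE in_cons eqxx /= {1}/p /proj_free /coef_op.
  congr (Ds i (iter _ _ _)); rewrite /state upd_same.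
  (* i is not in s, so the coordinate i survives zero_on s *)
  have zk m : zero_on s (upd i m k) = upd i m (zero_on (i :: s) k).
    apply/ffunP => j; rewrite !ffunE in_cons; have [->|ji] //= := eqVneq j i.
    by rewrite (negPf is_).
  have -> : (fun m => b (upd i (0 + m) (upd i 0%N k))) =
      mcoef s k \o (fun m => w (upd i (0 + m) (zero_on (i :: s) k))).
    by apply/funext => m /=; rewrite upd_upd bE mcoef_upd // zk.
  rewrite -(obs_map (M := M)) ?ffunE ?in_cons ?eqxx //.
  + exact: mcoef_lcontr.
  + move=> y; apply/esym/mcoef_comm => j m v js; apply: coef_commT.
    by apply: contraNneq is_ => ->.
  + move=> y; apply/esym/mcoef_comm => j m v js; apply: coef_commDs.
    by apply: contraNneq is_ => ->.
  + by move=> N; exact: (slice_sums_le i _ N wM).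
Qed.

End Model.

(** * Orthogonal decompositions of Hardy spaces *)

Section HardyFunctions.
Context (R : realType) (H : completeNormedModType R[i]) (dot : {dot H for Num.conj}).
Hypothesis hdot : forall x, dot x x = `|x| ^+ 2.
Context (n : nat) (E : set H).
Local Notation C := (R[i]).
Local Notation I := {ffun 'I_n -> nat}.
Local Notation H2 := (@hardy R H n E).
Local Notation hd := (@hardy_dot R H n dot).
Hypothesis E0 : E 0.
Hypothesis Elin : forall (c : C) x y, E x -> E y -> E (c *: x + y).

Lemma hsum_lin (c : C) (a b : I -> H) : l2 a -> l2 b ->
  hsum (fun k => c *: a k + b k) = c *: hsum a + hsum b :> (polydisc R n -> H).
Proof.
move=> ha hb; apply/funext => z.
have [A hA] := l2_bounded ha; have [B hB] := l2_bounded hb.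
by rewrite (hsumD z (bounded_familyZ c hA) hB) (hsumZ c z hA).
Qed.

Lemma hardy0 : H2 0.
Proof.
apply/hardyP; exists (fun=> 0) => //; split.
  by exists 0 => J; rewrite big1 // => k _; rewrite normr0 expr0n.
by apply/funext => z; rewrite /hsum (@has_sum_sum _ _ _ _ 0) //; apply: has_sum0 => k; rewrite scaler0.
Qed.

Lemma hardy_lin (c : C) f g : H2 f -> H2 g -> H2 (c *: f + g).
Proof.
move=> /hardyP[a Ea [ha ->]] /hardyP[b Eb [hb ->]].
apply/hardyP; exists (fun k => c *: a k + b k); first by move=> k; exact: Elin.
by split; [exact: (l2D hdot (l2Z c ha) hb)|rewrite hsum_lin].
Qed.

Lemma hardyD f g : H2 f -> H2 g -> H2 (f + g).
Proof. by move=> hf hg; rewrite -[f]scale1r; exact: hardy_lin. Qed.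

Lemma hardyB f g : H2 f -> H2 g -> H2 (f - g).
Proof. by move=> hf hg; rewrite -scaleN1r addrC; exact: hardy_lin. Qed.

Lemma hardy_dot_lin (c : C) f g h : H2 f -> H2 g -> H2 h ->
  hd (c *: f + g) h = c * hd f h + hd g h.
Proof.
move=> /hardyP[a _ [ha ->]] /hardyP[b _ [hb ->]] /hardyP[d _ [hc ->]].
rewrite -hsum_lin // !hardy_dotE //; last exact: (l2D hdot (l2Z c ha) hb).
by rewrite (ldotDl hdot (l2Z c ha) hb hc) (ldotZl hdot c ha hc).
Qed.

Lemma hardy_dotD f g h : H2 f -> H2 g -> H2 h -> hd (f + g) h = hd f h + hd g h.
Proof. by move=> hf hg hh; have := hardy_dot_lin 1 hf hg hh; rewrite scale1r mul1r. Qed.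

Lemma hardy_dotB f g h : H2 f -> H2 g -> H2 h -> hd (f - g) h = hd f h - hd g h.
Proof.
move=> hf hg hh; have := hardy_dot_lin (-1) hg hf hh.
by rewrite scaleN1r mulN1r addrC => ->; rewrite addrC.
Qed.

Lemma hardy_dotC f g : H2 f -> H2 g -> hd f g = Num.conj (hd g f).
Proof.
move=> /hardyP[a _ [ha ->]] /hardyP[b _ [hb ->]].
by rewrite !hardy_dotE // -(ldotC hdot).
Qed.

Lemma hardy_dot_ge0 f : H2 f -> 0 <= hd f f.
Proof.
by move=> /hardyP[a _ [ha ->]]; rewrite hardy_dotE //; exact: sums_le_ge0 (ldot_ge0 hdot ha).
Qed.

Lemma hardy_dot_eq0 f : H2 f -> hd f f = 0 -> f = 0.
Proof.
move=> /hardyP[a _ [ha ->]]; rewrite hardy_dotE // => /(ldot_eq0 hdot ha) a0.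
apply/funext => z; rewrite /hsum (@has_sum_sum _ _ _ _ 0) //.
by apply: has_sum0 => k; rewrite a0 scaler0.
Qed.

Lemma hardy_dotDr f g h : H2 f -> H2 g -> H2 h -> hd h (f + g) = hd h f + hd h g.
Proof.
move=> hf hg hh; rewrite (hardy_dotC hh (hardyD hf hg)) hardy_dotD // rmorphD /=.
by rewrite -!hardy_dotC.
Qed.

Lemma hardy_dotBr f g h : H2 f -> H2 g -> H2 h -> hd h (f - g) = hd h f - hd h g.
Proof.
move=> hf hg hh; rewrite (hardy_dotC hh (hardyB hf hg)) hardy_dotB // rmorphB /=.
by rewrite -!hardy_dotC.
Qed.
End HardyFunctions.

(** Given an isometry [U] into the Hardy space, and a set [S] orthogonal to its
    range that together with the range fills up the space, both [S] and the
    range are orthogonal complements of each other. *)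
Section OrthogonalDecomposition.
Context (R : realType) (H : completeNormedModType R[i]) (dot : {dot H for Num.conj}).
Hypothesis hdot : forall x, dot x x = `|x| ^+ 2.
Context (n : nat) (E : set H).
Local Notation C := (R[i]).
Local Notation H2 := (@hardy R H n E).
Local Notation hd := (@hardy_dot R H n dot).
Hypothesis E0 : E 0.
Hypothesis Elin : forall (c : C) x y, E x -> E y -> E (c *: x + y).
Variables (U : {linear H -> (polydisc R n -> H)}) (S : set (polydisc R n -> H)).
Hypothesis UH2 : forall x, H2 (U x).
Hypothesis Udot : forall x y, hd (U x) (U y) = dot x y.
Hypothesis SH2 : S `<=` H2.
Hypothesis SU : forall f x, S f -> hd f (U x) = 0.
Hypothesis decomp : forall f, H2 f -> exists2 g, S g & exists x, f = g + U x.
Local Notation Q := (orthocomplement hd H2 S).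

Let US f x : S f -> hd (U x) f = 0.
Proof.
by move=> Sf; rewrite (hardy_dotC hdot (UH2 x) (SH2 Sf)) SU // rmorph0.
Qed.

Lemma decomp_dot f x g y : S f -> S g -> hd (f + U x) (g + U y) = hd f g + dot x y.
Proof.
move=> Sf Sg; have [hf hg] := (SH2 Sf, SH2 Sg).
rewrite (@hardy_dotD _ _ _ hdot _ E) //; last exact: (hardyD hdot).
rewrite !(@hardy_dotDr _ _ _ hdot _ E Elin) // (SU _ Sf) (US _ Sg) Udot.
by rewrite addr0 add0r.
Qed.

Lemma perp_char f : S f <-> H2 f /\ forall x, hd f (U x) = 0.
Proof.
split=> [Sf|[hf fU]]; first by split=> [|x]; [exact: SH2|exact: SU].
have [g Sg [x fE]] := decomp hf; have := fU x.
rewrite fE (@hardy_dotD _ _ _ hdot _ E) //; last exact: SH2.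
rewrite (SU _ Sg) Udot add0r => x0.
by rewrite (dot_eq0 hdot x0) linear0 addr0.
Qed.

Lemma orthocomplement_char f : Q f <-> exists x, f = U x.
Proof.
split=> [[hf fS]|[x ->]]; last by split=> [|g Sg]; [exact: UH2|exact: SU].
have [g Sg [x fE]] := decomp hf; exists x; have := fS g Sg.
rewrite fE (@hardy_dotDr _ _ _ hdot _ E Elin) //; [|exact: SH2|exact: SH2].
rewrite (SU _ Sg) addr0 => g0.
by rewrite (hardy_dot_eq0 hdot (SH2 Sg) g0) add0r.
Qed.

(** If [g + U x] is a limit of elements of [S], then its distance to each of them
    is at least the norm of [x] by Pythagoras, so [x = 0]. *)
Lemma perp_closed : closed_subspace hd H2 S.
Proof.
split=> // [||f hf h].
- by apply/perp_char; split=> [|x]; [exact: hardy0|rewrite -(linear0 U) Udot dot0l].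
- move=> c f g /perp_char[hf fU] /perp_char[hg gU]; apply/perp_char.
  split=> [|x]; first exact: (hardy_lin hdot).
  by rewrite (@hardy_dot_lin _ _ _ hdot _ E) // fU gU mulr0 addr0.
- have [g Sg [x fE]] := decomp hf.
  suff x0 : x = 0 by rewrite fE x0 linear0 addr0.
  apply/eqP; rewrite -normr_eq0 -sqrf_eq0; apply/negPn/negP => nx.
  have px : 0 < `|x| ^+ 2 by rewrite lt_neqAle eq_sym nx exprn_ge0.
  have [g' Sg' ] := h _ px.
  have Sgg : S (g - g').
    apply/perp_char; split=> [|y]; first by apply: (hardyB hdot) => //; exact: SH2.
    by rewrite (@hardy_dotB _ _ _ hdot _ E) ?SU ?subrr //; exact: SH2.
  rewrite fE addrAC decomp_dot // hdot => lt.
  suff le : `|x| ^+ 2 <= hd (g - g') (g - g') + `|x| ^+ 2.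
    by have := le_lt_trans le lt; rewrite ltxx.
  by rewrite lerDr; apply: (hardy_dot_ge0 hdot (E := E)); exact: SH2.
Qed.

Lemma orthocomplement_closed : closed_subspace hd H2 Q.
Proof.
split=> // [f []//|||f hf h].
- by apply/orthocomplement_char; exists 0; rewrite linear0.
- move=> c f g /orthocomplement_char[x ->] /orthocomplement_char[y ->].
  by apply/orthocomplement_char; exists (c *: x + y); rewrite linearP.
- have [g Sg [x fE]] := decomp hf.
  apply/orthocomplement_char; exists x.
  suff g0 : g = 0 by rewrite fE g0 add0r.
  apply: (hardy_dot_eq0 hdot (SH2 Sg)); apply/eqP/negPn/negP => ng.
  have pg : 0 < hd g g by rewrite lt_neqAle eq_sym ng (hardy_dot_ge0 hdot (SH2 Sg)).
  have [f' /orthocomplement_char[y ->]] := h _ pg.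
  rewrite fE -addrA -linearB decomp_dot // => lt.
  suff le : hd g g <= hd g g + dot (x - y) (x - y).
    by have := le_lt_trans le lt; rewrite ltxx.
  by rewrite lerDl hdot exprn_ge0.
Qed.

Lemma unitary_onto_orthocomplement : unitary_onto dot setT hd Q U.
Proof.
split=> [x y _ _|]; first exact: Udot.
apply/seteqP; split=> [_ [x _ <-]|f /orthocomplement_char[x ->]]; last by exists x.
by apply/orthocomplement_char; exists x.
Qed.

Variables (A B : H -> H) (M : (polydisc R n -> H) -> (polydisc R n -> H)).
Hypothesis AB : adjoint_pair dot A B.
Hypothesis MH2 : forall f, H2 f -> H2 (M f).
Hypothesis MU : forall f x, H2 f -> hd (M f) (U x) = hd f (U (B x)).

Lemma perp_invariant : invariant_under M S.
Proof.
move=> f /perp_char[hf fU]; apply/perp_char; split=> [|x]; first exact: MH2.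
by rewrite MU.
Qed.

(** The relation [MU] says that [U (B x)] has the property defining the adjoint. *)
Lemma adjoint_on_range x : adjoint hd H2 hd M (U x) = U (B x).
Proof.
rewrite /adjoint; set P := [set _ | _].
have [hp pE] : P (xget 0 P).
  by apply: xgetPex; exists (U (B x)); split=> // f hf; exact: MU.
have hB : H2 (xget 0 P - U (B x)) by exact: (hardyB hdot).
apply/subr0_eq/(hardy_dot_eq0 hdot hB).
by rewrite (@hardy_dotBr _ _ _ hdot _ E Elin) // -pE // MU // subrr.
Qed.

Lemma orthocomplement_invariant : invariant_under (adjoint hd H2 hd M) Q.
Proof.
move=> _ /orthocomplement_char[x ->]; rewrite adjoint_on_range.
by apply/orthocomplement_char; exists (B x).
Qed.

Lemma compression f : Q f ->
  U (A (adjoint dot setT hd U f)) = orthoproj hd Q (M f).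
Proof.
move=> /orthocomplement_char[x ->].
have -> : adjoint dot setT hd U (U x) = x.
  rewrite /adjoint; set P := [set _ | _].
  have [_ pE] : P (xget 0 P) by apply: xgetPex; exists x; split.
  by apply: (dot_injr hdot) => z; rewrite -(pE z Logic.I) Udot.
rewrite /orthoproj; set P := [set _ | _].
have [/orthocomplement_char[y yE] hy] : P (xget 0 P).
  apply: xgetPex; exists (U (A x)); split; first by apply/orthocomplement_char; exists (A x).
  move=> _ /orthocomplement_char[y ->]; rewrite (@hardy_dotB _ _ _ hdot _ E) //; last exact: MH2.
  by rewrite MU // !Udot AB subrr.
rewrite yE; congr (U _); apply/subr0_eq/(dot_eq0 hdot).
have := hy (U (A x - y)); rewrite yE (@hardy_dotB _ _ _ hdot _ E) //; last exact: MH2.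
rewrite MU // !Udot -AB -dotBl; apply.
by apply/orthocomplement_char; exists (A x - y).
Qed.
End OrthogonalDecomposition.

(** * The model theorem *)

Section ModelSubspace.
Context (R : realType) (H : completeNormedModType R[i]) (dot : {dot H for Num.conj}).
Hypothesis hdot : forall x, dot x x = `|x| ^+ 2.
Context (n : nat) (T : 'I_n -> H -> H).
Local Notation C := (R[i]).
Local Notation I := {ffun 'I_n -> nat}.
Hypothesis hT : forall i, lcontr (T i).
Hypothesis TT : forall i j x, i != j -> T i (T j x) = T j (T i x).
Hypothesis TTadj : forall i j x, i != j ->
  T i (hadjoint dot (T j) x) = hadjoint dot (T j) (T i x).
Hypothesis pure : forall i, class_C_dot_0 dot (T i).
Local Notation E := (joint_defect_adj_space dot T).
Local Notation H2 := (model_hardy dot T).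
Local Notation S := (S_T dot T).

Lemma joint_defect_space0 : E 0.
Proof. exact/closed_range0/joint_defect_adj_lcontr. Qed.

Lemma joint_defect_space_lin (c : C) x y : E x -> E y -> E (c *: x + y).
Proof. exact/closed_range_lin/joint_defect_adj_lcontr. Qed.

Definition dilation (x : H) : polydisc R n -> H := hsum (model_coef dot T x).

Lemma dilation_linear : linear dilation.
Proof.
move=> c x y; rewrite /dilation (model_coef_lin hdot hT).
by rewrite hsum_lin //; exact: (model_coef_l2 hdot).
Qed.

Lemma dilation_hardy x : H2 (dilation x).
Proof.
apply/hardyP; exists (model_coef dot T x); first by move=> k; exact: mcoef_in_E.
by split=> //; exact: (model_coef_l2 hdot).
Qed.

Lemma dilation_dot x y : hardy_dot dot (dilation x) (dilation y) = dot x y.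
Proof.
by rewrite hardy_dotE ?(model_coef_dot hdot) //; exact: (model_coef_l2 hdot).
Qed.

Lemma char_rangeP i (f : polydisc R n -> H) :
  (H2 `&` char_mult dot T i @` hardy (defect_space dot (T i))) f <->
  exists2 c, char_range dot T i c & f = hsum c.
Proof.
split=> [[/hardyP[c Ec [hc ->]] [_ /hardyP[u Du [hu ->]] e]]|[c [hc Ec [u [hu Du huc]]] ->]].
  exists c => //; split=> //; exists u; split=> // z.
  by have := congr1 (@^~ z) e.
split; first by apply/hardyP; exists c.
exists (hsum u); first by apply/hardyP; exists u.
by apply/funext => z; exact: huc.
Qed.

Lemma S_T_perp f : S f -> H2 f /\ forall x, hardy_dot dot f (dilation x) = 0.
Proof.
move=> [g hg ->]; apply: (big_ind (fun f => H2 f /\ forall x, hardy_dot dot f (dilation x) = 0)).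
- split; first exact: (hardy0 n joint_defect_space0).
  move=> x; have h0 : dilation 0 = 0.
    by have := dilation_linear (-1) 0 0; rewrite !scaler0 addr0 => ->; rewrite scaleN1r addNr.
  by rewrite -h0 dilation_dot dot0l.
- move=> f1 f2 [h1 o1] [h2 o2]; split; first exact: (hardyD hdot joint_defect_space_lin).
  move=> x; rewrite (hardy_dotD hdot h1 h2 (dilation_hardy x)).
  by rewrite o1 o2 addr0.
- move=> i _; have /char_rangeP[c hc ->] := hg i; split.
    by have [hl Ec _] := hc; apply/hardyP; exists c.
  move=> x; have [hl _ _] := hc; rewrite hardy_dotE //; last exact: (model_coef_l2 hdot).
  exact: (char_range_orthogonal hdot hT TT TTadj pure x hc).
Qed.

Lemma hsum_sum (r : seq 'I_n) (g : 'I_n -> I -> H) : (forall j, l2 (g j)) ->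
  l2 (fun k => \sum_(j <- r) g j k) /\
  hsum (fun k => \sum_(j <- r) g j k) = \sum_(j <- r) hsum (g j) :> (polydisc R n -> H).
Proof.
move=> hg; elim: r => [|j r [IH1 IH2]].
  have e : (fun k : I => \sum_(j <- [::]) g j k) = (fun=> 0) by apply/funext => k; rewrite big_nil.
  rewrite e big_nil; split; first by exists 0 => J; rewrite big1 // => k _; rewrite normr0 expr0n.
  apply/funext => z; rewrite /hsum (@has_sum_sum _ _ _ _ 0) //.
  by apply: has_sum0 => k; rewrite scaler0.
have e : (fun k : I => \sum_(j0 <- j :: r) g j0 k) = (fun k => 1 *: g j k + \sum_(j0 <- r) g j0 k).
  by apply/funext => k; rewrite big_cons scale1r.
rewrite e big_cons hsum_lin // scale1r IH2; split=> //.
exact: (l2D hdot (l2Z 1 (hg j)) IH1).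
Qed.

Lemma model_decomposition f : H2 f -> exists2 g, S g & exists x, f = g + dilation x.
Proof.
move=> /hardyP[a Ea [ha ->]].
have [g [b [w [hg ab [hb _] _ bE]]]] :=
  char_range_decomposition hdot hT TT TTadj (index_enum_uniq 'I_n) ha Ea.
have hgi i : char_range dot T i (g i) by apply: hg; exact: mem_index_enum.
have [|hs hsE] := @hsum_sum (index_enum 'I_n) g; first by move=> i; case: (hgi i).
exists (\sum_(i < n) hsum (g i)).
  by exists (fun i => hsum (g i)) => // i; apply/char_rangeP; exists (g i).
exists (w [ffun=> 0%N]); rewrite -hsE -[X in X + _]scale1r -hsum_lin //; last exact: (model_coef_l2 hdot).
congr hsum; apply/funext => k; rewrite scale1r ab bE; congr (_ + mcoef _ _ _ _ (w _)).
by apply/ffunP => j; rewrite !ffunE mem_index_enum.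
Qed.

Lemma mult_coord_hardy i f : H2 f -> H2 (mult_coord i f).
Proof.
move=> /hardyP[a Ea [ha ->]]; rewrite mult_coord_hsum //.
apply/hardyP; exists (fshift i a); first exact: fshift_E.
by split=> //; exact: l2_fshift.
Qed.

Lemma mult_coord_dilation i f x : H2 f ->
  hardy_dot dot (mult_coord i f) (dilation x) =
  hardy_dot dot f (dilation (hadjoint dot (T i) x)).
Proof.
move=> /hardyP[a _ [ha ->]]; rewrite mult_coord_hsum //.
have ml := model_coef_l2 hdot hT pure.
have e : (fun k => model_coef dot T x (midx_succ i k)) = model_coef dot T (hadjoint dot (T i) x).
  by apply/funext => k; exact: model_coef_succ.
rewrite !hardy_dotE //; last exact: l2_fshift.
by rewrite (ldot_fshift hdot) // e.
Qed.
End ModelSubspace.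

Theorem theorem4p5 (R : realType) (H : completeNormedModType R[i])
    (dot : {dot H for Num.conj}) (hdot : forall x, dot x x = `|x| ^+ 2)
    (n : nat) (hn : (2 <= n)%N) (T : 'I_n -> {linear H -> H})
    (hT : doubly_commuting_pure dot T) :
  let M := @mult_coord R H n in
  let H2 := model_hardy dot (fun i => T i) in
  let S := S_T dot (fun i => T i) in
  let Q := Q_T dot (fun i => T i) in
  [/\ closed_subspace (hardy_dot dot) H2 S /\
        (forall i, invariant_under (M i) S),
      closed_subspace (hardy_dot dot) H2 Q /\
        (forall i,
           invariant_under (adjoint (hardy_dot dot) H2 (hardy_dot dot) (M i)) Q)
    & exists U : {linear H -> (polydisc R n -> H)},
        unitary_onto dot setT (hardy_dot dot) Q U /\
        forall i f, Q f ->
          U (T i (adjoint dot setT (hardy_dot dot) U f)) =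
          orthoproj (hardy_dot dot) Q (M i f)].
Proof.
move=> M H2 S Q; have [Tle [TT TTs] pure] := hT.
pose t i : H -> H := T i.
have ht i : lcontr (t i) by split; [exact: linearP|exact: Tle].
have tt i j x : i != j -> t i (t j x) = t j (t i x).
  by move=> _; exact: (congr1 (@^~ x) (TT i j)).
have tts i j x : i != j -> t i (hadjoint dot (t j) x) = hadjoint dot (t j) (t i x).
  by move=> ij; exact: (congr1 (@^~ x) (TTs i j ij)).
pose U : {linear H -> (polydisc R n -> H)} :=
  HB.pack (dilation dot t) (GRing.isLinear.Build _ _ _ _ _ (dilation_linear hdot ht pure)).
have E0 := joint_defect_space0 hdot ht.
have Elin := joint_defect_space_lin hdot ht.
have UH2 : forall x, H2 (U x) := dilation_hardy hdot ht tt tts pure.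
have Udot : forall x y, hardy_dot dot (U x) (U y) = dot x y := dilation_dot hdot ht pure.
have SH2 : S `<=` H2 by move=> f /(S_T_perp hdot ht tt tts pure)[].
have SU : forall f x, S f -> hardy_dot dot f (U x) = 0.
  by move=> f x /(S_T_perp hdot ht tt tts pure)[_ ->].
have dec : forall f, H2 f -> exists2 g, S g & exists x, f = g + U x.
  by move=> f hf; have [g Sg [x fE]] := model_decomposition hdot ht tt tts pure hf; exists g => //; exists x.
have MH2 i : forall f, H2 f -> H2 (M i f) by move=> f; exact: mult_coord_hardy.
have MU i : forall f x, H2 f ->
    hardy_dot dot (M i f) (U x) = hardy_dot dot f (U (hadjoint dot (t i) x)).
  by move=> f x; exact: mult_coord_dilation.
split; first split.
- exact: (perp_closed hdot E0 Elin UH2 Udot SH2 SU dec).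
- by move=> i; apply: (perp_invariant hdot UH2 Udot SH2 SU dec (MH2 i) (MU i)).
- split; first exact: (orthocomplement_closed hdot Elin UH2 Udot SH2 SU dec).
  by move=> i; apply: (orthocomplement_invariant hdot Elin UH2 SH2 SU dec (MU i)).
exists U; split; first exact: (unitary_onto_orthocomplement hdot Elin UH2 Udot SH2 SU dec).
move=> i f; exact: (compression hdot Elin UH2 Udot SH2 SU dec (hadjointP hdot (ht i)) (MH2 i) (MU i)).
Qed.
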